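(* For every $q,r\in(0,\infty]$ and $\Phi,K\geq 1$ there exist constants $C_1=C_1(q,r,\Phi,K)$ and $C_2=C_2(q,r,\Phi,K)$ such that the following holds. Let $X$ be a finite set, $\mu,\nu$ outer measures on $X$, $\omega$ a measure on $X$, and $\mathcal{C}$ a $\mu$-covering function (with parameter $\Phi$) such that $(X,\mu,\nu,\mathcal{C})$ satisfies the canopy condition with parameters $\Phi,K$. Then for every function $f\in L^q_\mu(\ell^q_\nu(\ell^r_\omega))$ on $X$, $$C_1^{-1}\|f\|_{L^q_\nu(\ell^r_\omega)}\leq \|f\|_{L^q_\mu(\ell^q_\nu(\ell^r_\omega))}\leq C_2\|f\|_{L^q_\nu(\ell^r_\omega)}.$$ Moreover, if $q\leq r$ or $q=\infty$, the constant $C_1$ can be chosen independent of $\Phi,K$; if $q\geq r$, the constant $C_2$ can be chosen independent of $\Phi,K$.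
   Context: An outer measure on a set $X$ is a monotone, subadditive function $\mathcal P(X)\to[0,\infty]$ vanishing on $\varnothing$. Standing assumptions: every outer measure is finite and strictly positive on every nonempty subset of $X$; every measure $\omega$ is given by a finite strictly positive weight, $\omega(A)=\sum_{x\in A}\omega(x)$. Convention $\infty^{-1}=0$. Iterated outer $L^p$ quasi-norms. For $r\in(0,\infty]$, a function $f$ on $X$ and nonempty $A\subseteq X$, set $\ell^r_\omega(f)(A)=\nu(A)^{-1/r}\|f1_A\|_{L^r(X,\omega)}$; $\|f\|_{L^\infty_\nu(\ell^r_\omega)}=\sup_{\varnothing\neq A\subseteq X}\ell^r_\omega(f)(A)$; for $\lambda>0$, $\nu(\ell^r_\omega(f)>\lambda)=\inf\{\nu(B):B\subseteq X,\ \|f1_{X\setminus B}\|_{L^\infty_\nu(\ell^r_\omega)}\leq\lambda\}$; for $q\in(0,\infty)$, $\|f\|_{L^q_\nu(\ell^r_\omega)}=\big(\int_0^\infty q\lambda^{q-1}\nu(\ell^r_\omega(f)>\lambda)\,d\lambda\big)^{1/q}$. Next, for $q\in(0,\infty]$ and nonempty $A$, $\ell^q_\nu(\ell^r_\omega)(f)(A)=\mu(A)^{-1/q}\|f1_A\|_{L^q_\nu(\ell^r_\omega)}$; $\|f\|_{L^\infty_\mu(\ell^q_\nu(\ell^r_\omega))}=\sup_{\varnothing\ne A}\ell^q_\nu(\ell^r_\omega)(f)(A)$; $\mu(\ell^q_\nu(\ell^r_\omega)(f)>\lambda)=\inf\{\mu(B):\|f1_{X\setminus B}\|_{L^\infty_\mu(\ell^q_\nu(\ell^r_\omega))}\le\lambda\}$;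 and for $p\in(0,\infty)$, $\|f\|_{L^p_\mu(\ell^q_\nu(\ell^r_\omega))}=\big(\int_0^\infty p\lambda^{p-1}\mu(\ell^q_\nu(\ell^r_\omega)(f)>\lambda)\,d\lambda\big)^{1/p}$. A function belongs to such a space if its quasi-norm is finite. Structures. Given $\Phi\ge1$, a $\mu$-covering function (with parameter $\Phi$) is, for some collection $\mathcal E$ of subsets of $X$, a map $\mathcal C$ assigning to each $A\subseteq X$ a subcollection $\mathcal C(A)\subseteq\mathcal E$ of pairwise disjoint sets, such that $\mathbf B_{\mathcal C}(A)=\bigcup_{E\in\mathcal C(A)}E$ satisfies: $A\subseteq\mathbf B_{\mathcal C}(A)$, $\mu(\mathbf B_{\mathcal C}(A))\le\Phi\mu(A)$, and $A_1\subseteq A_2\Rightarrow\mathbf B_{\mathcal C}(A_1)\subseteq\mathbf B_{\mathcal C}(A_2)$. Given $K\ge1$, a collection $\mathcal A$ of pairwise disjoint subsets of $X$ is $\nu$-Carathéodory (with parameter $K$) if $\sum_{A\in\mathcal A}\nu(U\cap A)\le K\nu(U\cap\bigcup_{A\in\mathcal A}A)$ for every $U\subseteq X$. $(X,\mu,\nu,\mathcal C)$ satisfies the canopy condition (with parameters $\Phi,K$) if $\mathcal C$ is a $\mu$-covering function with parameter $\Phi$ and, for every $\nu$-Carathéodory collection $\mathcal A$ (parameter $K$) and every $D\subseteq X$ disjoint from $\mathbf B_{\mathcal C}(\bigcup_{A\in\mathcal A}A)$, the collection $\mathcal A\cup\{D\}$ is still $\nu$-Carathéodory (parameter $K$). 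*)

(* Defs.v *)
From HB Require Import structures.
From mathcomp Require Import all_boot all_order all_algebra.
From mathcomp Require Import all_classical all_reals.
From mathcomp Require Import ereal exp measure lebesgue_measure lebesgue_integral.
Set Implicit Arguments. Unset Strict Implicit. Unset Printing Implicit Defensive.
Import Order.TTheory GRing.Theory Num.Theory.
Local Open Scope ring_scope.


Section Defs.
Context {R : realType} {T : finType}.

Definition restr (A : {set T}) (f : T -> R) : T -> R :=
  fun x => if x \in A then f x else 0.

Definition outer_meas (m : {set T} -> R) : Prop :=
  [/\ m finset.set0 = 0,
      (forall A B : {set T}, A \subset B -> m A <= m B),
      (forall A B : {set T}, m (A :|: B) <= m A + m B) &
      (forall A : {set T}, A != finset.set0 -> 0 < m A)].

(* measure given by finite strictly positive weights *)
Definition pos_weight (w : T -> R) : Prop := forall x, 0 < w x.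

Definition exponent_ok (p : \bar R) : Prop := (0 < p)%E.
Definition expinv (p : \bar R) : R := if p is r%:E then r^-1 else 0.

Definition Lr_omega (r : \bar R) (w : T -> R) (f : T -> R) : \bar R :=
  if r is r'%:E then
    ((\sum_x w x * `|f x| `^ r') `^ (r'^-1))%:E
  else (\big[Num.max/0]_x `|f x|)%:E.

Definition lsize (p : \bar R) (m : {set T} -> R) (N : (T -> R) -> \bar R)
  (f : T -> R) (A : {set T}) : \bar R :=
  ((m A) `^ (- expinv p))%:E * N (restr A f).

Definition outerLinf (S : (T -> R) -> {set T} -> \bar R) (f : T -> R) : \bar R :=
  \big[Order.max/0%E]_(A : {set T} | A != finset.set0) S f A.

Definition outer_superlevel (m : {set T} -> R) (S : (T -> R) -> {set T} -> \bar R)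
  (f : T -> R) (lam : R) : \bar R :=
  ereal_inf [set (m B)%:E | B in [set B : {set T} | (outerLinf S (restr (~: B) f) <= lam%:E)%E]]%classic.

Definition outerLp (p : \bar R) (m : {set T} -> R) (S : (T -> R) -> {set T} -> \bar R)
  (f : T -> R) : \bar R :=
  if p is p'%:E then
    poweR (\int[lebesgue_measure]_(lam in `]0%R, +oo[)
             ((p' * lam `^ (p' - 1))%:E * outer_superlevel m S f lam))%E (p'^-1)
  else outerLinf S f.

Definition norm2 (q r : \bar R) (nu : {set T} -> R) (w : T -> R) (f : T -> R) :=
  outerLp q nu (lsize r nu (Lr_omega r w)) f.

Definition norm3 (p q r : \bar R) (mu nu : {set T} -> R) (w : T -> R) (f : T -> R) :=
  outerLp p mu (lsize q mu (norm2 q r nu w)) f.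

Definition covering_function (mu : {set T} -> R) (Phi : R)
  (C : {set T} -> {set {set T}}) : Prop :=
  [/\ (forall A : {set T}, finset.trivIset (C A)),
      (forall A : {set T}, A \subset finset.cover (C A)),
      (forall A : {set T}, mu (finset.cover (C A)) <= Phi * mu A) &
      (forall A1 A2 : {set T}, A1 \subset A2 -> finset.cover (C A1) \subset finset.cover (C A2))].

Definition carath (nu : {set T} -> R) (K : R) (P : {set {set T}}) : Prop :=
  finset.trivIset P /\
  forall U : {set T}, \sum_(A in P) nu (U :&: A) <= K * nu (U :&: finset.cover P).

Definition canopy (mu nu : {set T} -> R) (C : {set T} -> {set {set T}})
  (Phi K : R) : Prop :=
  covering_function mu Phi C /\
  forall (P : {set {set T}}) (D : {set T}),
    carath nu K P -> [disjoint D & finset.cover (C (finset.cover P))] ->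
    carath nu K (D |: P).

End Defs.

(* Main.v *)
(* For q = oo the two quasi-norms coincide. For q < oo and r < oo put g = w |f|^r. Selecting
   again and again, among the points not used yet, a set A of largest density g(A) / nu(A)
   produces disjoint sets and a function tau, equal on each selected set to its density, such
   that ||f||^q in L^q_nu(l^r) is comparable to [\sum_x g x * tau x ^ (q/r - 1)], with
   constants depending on q/r only. Hence F(A) = ||f 1_A||^q is superadditive up to a constant
   on disjoint families if q >= r, and subadditive up to a constant if q <= r; along
   Caratheodory families both properties hold for all q and r, with constants depending on K.
   (For r = oo, F is subadditive because nu is: its superlevel measures are nu(|f| > l).)

   Upper bound for the triple norm: select greedily sets of largest density F(A) / mu(A), each
   outside the canopy of the previous ones. The superlevel measures of the triple norm are
   dominated by the measures of the canopies, so its q-th power is at most Phi \sum F(A), and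
   the selected family is Caratheodory. If q >= r, superadditivity allows one to select
   without canopies.

   Lower bound: take optimal exceptional sets for mu at the levels L (2 Phi)^-k, each enlarged
   by the canopy of the previous one. The layers between consecutive sets satisfy
   \sum F(layer) <= 8 Phi times the q-th power of the triple norm, because the ratio 2 Phi
   absorbs the loss Phi of each enlargement, and the layers of a given parity form a
   Caratheodory family. If q <= r, subadditivity makes the canopies unnecessary. *)
Require Import Defs.
From HB Require Import structures.
From mathcomp Require Import all_boot all_order all_algebra.
From mathcomp Require Import reals exp.
From mathcomp Require Import ring lra.
Set Implicit Arguments. Unset Strict Implicit. Unset Printing Implicit Defensive.
Import Order.TTheory GRing.Theory Num.Theory.
Local Open Scope ring_scope.

(** * Superlevel measures and greedy selection *)

Section Infimum.
Context {R : realType} {T : finType}.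
Implicit Types (A B D U : {set T}) (m H : {set T} -> R) (P : {set T} -> bool).

(* [m setT] is a junk starting value: [P setT] holds in all uses. *)
Definition minval P m : R := \big[Num.min/m setT]_(B | P B) m B.

Lemma minval_le P m B : P B -> minval P m <= m B.
Proof. by move=> PB; rewrite /minval (bigD1 B)//= ge_min lexx. Qed.

Lemma minval_attained P m : P setT -> exists2 B, P B & m B = minval P m.
Proof.
move=> PT; rewrite /minval; elim/big_ind: _ => [|x y [B PB <-] [D PD <-]|B PB].
- by exists setT.
- by case: (leP (m B) (m D)) => _; [exists B|exists D].
- by exists B.
Qed.

Lemma minval_anti P P' m : (forall B, P B -> P' B) -> P setT ->
  minval P' m <= minval P m.
Proof. by move=> PP' /(minval_attained m)[B PB <-]; exact/minval_le/PP'. Qed.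

Lemma minval_ge0 P m : P setT -> (forall A, 0 <= m A) -> 0 <= minval P m.
Proof. by move=> /(minval_attained m)[B _ <-]. Qed.

Section OuterMeasure.
Variable m : {set T} -> R.
Hypothesis om : outer_meas m.

Lemma outer0 : m set0 = 0. Proof. by case: om. Qed.

Lemma outer_mono A B : A \subset B -> m A <= m B.
Proof. by case: om => _ + _ _; apply. Qed.

Lemma outer_ge0 A : 0 <= m A.
Proof. by rewrite -outer0; apply: outer_mono; rewrite sub0set. Qed.

Lemma outer_gt0 A : A != set0 -> 0 < m A.
Proof. by case: om => _ _ _; apply. Qed.

Lemma outer_bigcup (I : eqType) (s : seq I) (F : I -> {set T}) (Q : pred I) A :
  (forall x, x \in A -> exists2 i, i \in s & Q i && (x \in F i)) ->
  m A <= \sum_(i <- s | Q i) m (F i).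
Proof.
case: om => m0 _ mU _.
elim: s A => [|i s IH] A cA.
  rewrite big_nil; suff -> : A = set0 by rewrite m0.
  by apply/setP => x; rewrite inE; apply/negP => /cA[].
rewrite big_cons; case: ifPn => Qi.
  apply: le_trans (outer_mono (_ : A \subset F i :|: (A :\: F i))) _.
    by apply/subsetP => x xA; rewrite !inE xA andbT orbN.
  apply: le_trans (mU _ _) _; rewrite lerD2l; apply: IH => x.
  rewrite inE => /andP[xi /cA[j]]; rewrite inE => /predU1P[-> /andP[_ xi']|js Hj].
    by rewrite xi' in xi.
  by exists j.
apply: IH => x /cA[j]; rewrite inE => /predU1P[-> |js Hj].
  by rewrite (negPf Qi).
by exists j.
Qed.

End OuterMeasure.

(** The condition that all sizes of [f] off [B] are at most l, raised to the power p: [H A] stands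
    for the p-th power of the inner quasi-norm of [f] restricted to [A], and t = l^p. This keeps
    both outer structures linear in [H] and free of roots. *)
Definition admissible H m (t : R) B : bool :=
  [forall A : {set T}, (A \subset ~: B) ==> (H A <= t * m A)].

Lemma admissibleP H m t B :
  reflect (forall A, A \subset ~: B -> H A <= t * m A) (admissible H m t B).
Proof.
apply: (iffP forallP) => h A; first by move=> AB; exact: (implyP (h A)).
by apply/implyP; exact: h.
Qed.

Definition level H m t : R := minval (admissible H m t) m.

Section Level.
Variables (m H : {set T} -> R).
Hypotheses (om : outer_meas m) (H0 : H set0 = 0).

Lemma admissibleT t : admissible H m t setT.
Proof.
apply/admissibleP => A; rewrite setCT subset0 => /eqP ->.
by rewrite H0 outer0// mulr0.
Qed.

Lemma admissibleW t t' B : t <= t' -> admissible H m t B -> admissible H m t' B.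
Proof.
move=> tt' /admissibleP h; apply/admissibleP => A /h/le_trans; apply.
by rewrite ler_wpM2r// outer_ge0.
Qed.

Lemma level_ge0 t : 0 <= level H m t.
Proof. by apply: minval_ge0 => [|A]; [exact: admissibleT|exact: outer_ge0]. Qed.

Lemma level_noninc t t' : t <= t' -> level H m t' <= level H m t.
Proof.
move=> tt'; apply: minval_anti; last exact: admissibleT.
by move=> B; exact: admissibleW.
Qed.

End Level.

Section Greedy.
Variables (m H : {set T} -> R) (Cov : {set T} -> {set T}).
Hypotheses (om : outer_meas m) (H0 : H set0 = 0) (Hge0 : forall A, 0 <= H A).
Hypotheses (Cov_sub : forall A, A \subset Cov A)
  (Cov_mono : forall A B, A \subset B -> Cov A \subset Cov B).
Implicit Type s : seq {set T}.

Definition union s : {set T} := \bigcup_(A <- s) A.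
Definition density A : R := H A / m A.

Lemma unionP s x : reflect (exists2 A, A \in s & x \in A) (x \in union s).
Proof.
rewrite /union; elim: s => [|A s IH].
  by rewrite big_nil inE; constructor => -[].
rewrite big_cons inE; apply: (iffP orP) => [[xA|/IH[B Bs xB]]|[B]].
- by exists A => //; rewrite inE eqxx.
- by exists B => //; rewrite inE Bs orbT.
- rewrite inE => /predU1P[->|Bs xB]; first by left.
  by right; apply/IH; exists B.
Qed.

Lemma union_cons A s : union (A :: s) = A :|: union s.
Proof. by rewrite /union big_cons. Qed.

(** The head of the list is the set selected last. Its density is maximal among the sets avoiding
    the canopy of the earlier ones; taking [Cov] to be the identity gives selection without
    canopies. *)
Fixpoint greedy s : Prop :=
  if s is A :: s' then
    [/\ A \subset ~: Cov (union s'), 0 < density A,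
        (forall B, B \subset ~: Cov (union s') -> H B <= density A * m B)
      & greedy s']
  else True.

Lemma density_ge0 A : 0 <= density A.
Proof. by rewrite divr_ge0// outer_ge0. Qed.

Lemma densityK A : H A = density A * m A.
Proof.
have [->|An0] := eqVneq A set0; first by rewrite /density H0 outer0 ?mulr0.
by rewrite /density divfK// gt_eqF// outer_gt0.
Qed.

Lemma density_gt0_neq0 A : 0 < density A -> A != set0.
Proof. by apply: contraTneq => ->; rewrite /density H0 mul0r ltxx. Qed.

(** Induction on the number of points not yet covered: a set of positive density is nonempty and
    avoids the earlier union, so each selection lowers that number. *)
Lemma greedy_exists : exists2 s, greedy s &
  forall B, B \subset ~: Cov (union s) -> H B <= 0.
Proof.
suff ext n : forall s, greedy s -> (#|~: union s| <= n)%N ->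
    exists2 s, greedy s & forall B, B \subset ~: Cov (union s) -> H B <= 0.
  exact: (ext _ [::]).
elim: n => [|n IH] s gs sn; first exists s => // B Bs.
  suff -> : B = set0 by rewrite H0.
  apply/eqP; rewrite -subset0; apply: subset_trans Bs _.
  move: sn; rewrite leqn0 cards_eq0 => /eqP <-; rewrite setCS; exact: Cov_sub.
have [/existsP[B0 /andP[B0s HB0]]|/existsPn no] :=
    boolP [exists B : {set T}, (B \subset ~: Cov (union s)) && (0 < H B)]; last first.
  exists s => // B Bs; rewrite leNgt; move: (no B); by rewrite Bs.
pose Q := [pred B : {set T} | B \subset ~: Cov (union s)].
have QB0 : Q B0 by [].
case: (@arg_maxP _ _ _ B0 Q density QB0) => A QA Amax.
have B0n0 : B0 != set0 by apply: contraTneq HB0 => ->; rewrite H0 ltxx.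
have A0 : 0 < density A.
  by apply: lt_le_trans (Amax B0 QB0); rewrite divr_gt0// outer_gt0.
apply: (IH (A :: s)) => /=.
  split=> // B QB; rewrite densityK ler_wpM2r ?outer_ge0//.
  exact: (Amax B).
rewrite -ltnS; apply: leq_trans sn; apply: proper_card.
rewrite union_cons properE !setCS subsetUr subUset subxx andbT.
apply/negP => As.
have /set0Pn[x xA] := density_gt0_neq0 A0.
have := subsetP QA _ xA; rewrite inE => /negP; apply.
exact: (subsetP (Cov_sub _)) _ (subsetP As _ xA).
Qed.

(** Since [Cov] is monotone, a set selected later was already a candidate when [B] was chosen;
    densities decrease in the order of selection. *)
Lemma greedy_density_ge A s : greedy (A :: s) -> forall B, B \in s -> density A <= density B.
Proof.
move=> /= [As A0 _]; elim: s As => //= B s IH As [Bs B0 Bmax gs] D.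
have As' : A \subset ~: Cov (union s).
  apply: subset_trans As _; rewrite setCS; apply: Cov_mono.
  by rewrite union_cons subsetUr.
rewrite inE => /predU1P[->|]; last exact: IH.
by rewrite /density ler_pdivrMr ?Bmax// outer_gt0// density_gt0_neq0.
Qed.

(** The sets of density above t form an initial stage of the selection. The next set, of density at
    most t, was maximal off the canopy of that stage; if there is no next set, the hypothesis on the
    whole list applies. *)
Lemma greedy_admissible s t : greedy s ->
  (forall B, B \subset ~: Cov (union s) -> H B <= t * m B) ->
  forall B, B \subset ~: Cov (union [seq A <- s | t < density A]) -> H B <= t * m B.
Proof.
elim: s => [//|A s IH] gs ht.
case: (ltP t (density A)) => tA.
  suff -> : [seq B <- A :: s | t < density B] = A :: s by [].
  apply/all_filterP/allP => B; rewrite inE => /predU1P[-> //|Bs].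
  exact: lt_le_trans (greedy_density_ge gs Bs).
rewrite /= ltNge tA /=; case: gs => As A0 Amax gs.
apply: IH => // B Bs; apply: le_trans (Amax B Bs) _.
by rewrite ler_wpM2r// outer_ge0.
Qed.

Lemma greedy_level s t : greedy s -> 0 <= t ->
  (forall B, B \subset ~: Cov (union s) -> H B <= 0) ->
  level H m t <= m (Cov (union [seq A <- s | t < density A])).
Proof.
move=> gs t0 hs; apply/minval_le/admissibleP; apply: greedy_admissible => // B Bs.
by apply: le_trans (hs B Bs) _; rewrite mulr_ge0// outer_ge0.
Qed.

Lemma greedy_disjoint A s : greedy (A :: s) -> [disjoint A & union s].
Proof.
move=> [As _ _ _]; rewrite disjoints_subset; apply: subset_trans As _.
by rewrite setCS; exact: Cov_sub.
Qed.

Lemma greedy_sum s (h : T -> R) : greedy s ->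
  \sum_(A <- s) \sum_(x in A) h x = \sum_(x in union s) h x.
Proof.
elim: s => [_|A s IH gs]; first by rewrite /union !big_nil big_set0.
rewrite union_cons big_cons IH; last by case: gs.
have dA := greedy_disjoint gs; rewrite -bigU//=; by apply: eq_bigl => x; rewrite !inE.
Qed.

(** For a greedy list the sets are disjoint and the sum has at most one term: the density of the
    selected set through x, or 0 if there is none. *)
Definition stopping s x : R := \sum_(A <- s | x \in A) density A.

Lemma stopping_ge0 s x : 0 <= stopping s x.
Proof. by apply: sumr_ge0 => A _; exact: density_ge0. Qed.

Lemma stopping_notin s x : x \notin union s -> stopping s x = 0.
Proof.
move=> /unionP xs; rewrite /stopping big_seq_cond big1// => A /andP[As xA].
by case: xs; exists A.
Qed.

Lemma stoppingE s A x : greedy s -> A \in s -> x \in A -> stopping s x = density A.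
Proof.
elim: s => // B s IH gs; have dB := greedy_disjoint gs.
rewrite /stopping big_cons -/(stopping s x) inE => /predU1P[-> xB|As xA].
  by rewrite xB stopping_notin ?addr0// (disjointFr dB).
have xs : x \in union s by apply/unionP; exists A.
by rewrite (disjointFl dB xs); apply: IH => //; case: gs.
Qed.

Lemma greedy_density_gt0 s A : greedy s -> A \in s -> 0 < density A.
Proof.
elim: s => // B s IH [_ B0 _ gs]; rewrite inE => /predU1P[-> //|]; exact: IH.
Qed.

Lemma stopping_gtE s t x : greedy s -> 0 <= t ->
  (t < stopping s x) = (x \in union [seq A <- s | t < density A]).
Proof.
move=> gs t0; apply/idP/unionP => [tx|[A]].
  have [xs|/stopping_notin x0] := boolP (x \in union s); last first.
    by move: tx; rewrite x0 ltNge t0.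
  case/unionP: xs => A As xA; exists A => //; rewrite mem_filter As andbT.
  by rewrite -(stoppingE gs As xA).
by rewrite mem_filter => /andP[tA As] xA; rewrite (stoppingE gs As xA).
Qed.

End Greedy.

(** * Stopping times of additive set functions *)

Section Additive.
Variables (nu : {set T} -> R) (om : outer_meas nu).
Implicit Type g : T -> R.

Definition mass g (A : {set T}) : R := \sum_(x in A) g x.

Lemma mass_set0 g : mass g set0 = 0. Proof. exact: big_set0. Qed.

Lemma mass_ge0 g A : (forall x, 0 <= g x) -> 0 <= mass g A.
Proof. by move=> g0; apply: sumr_ge0. Qed.

Lemma mass_split g A (P : pred T) :
  mass g A = mass g [set x in A | P x] + mass g [set x in A | ~~ P x].
Proof.
rewrite /mass (bigID P)/=; congr (_ + _); apply: eq_bigl => x; by rewrite !inE.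
Qed.

(** The properties of a canopy-free greedy selection for [mass g] on which the estimates rest.
    [st_mass] expresses maximality: off the sets of density above t, no set has density exceeding
    t. *)
Record stopping_time g (s : seq {set T}) (tau : T -> R) : Prop := StoppingTime {
  st_ge0 : forall x, 0 <= tau x;
  st_mem : forall A, A \in s -> 0 < density nu (mass g) A /\
             forall x, x \in A -> tau x = density nu (mass g) A;
  st_cover : forall x, 0 < tau x -> exists2 A, A \in s & x \in A;
  st_sum : forall h : T -> R,
             \sum_(A <- s) \sum_(x in A) h x = \sum_(x | 0 < tau x) h x;
  st_mass : forall t A, 0 <= t -> (forall x, x \in A -> tau x <= t) ->
             mass g A <= t * nu A }.

Lemma stopping_time_exists g : (forall x, 0 <= g x) ->
  exists s tau, stopping_time g s tau.
Proof.
move=> g0.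
have G0 A : 0 <= mass g A by exact: mass_ge0.
have Cs (A : {set T}) : A \subset id A by [].
have [s gs hs] := greedy_exists om (mass_set0 g) Cs.
have tE t x : 0 <= t -> _ := @stopping_gtE nu (mass g) id Cs s t x gs.
exists s, (stopping nu (mass g) s); split.
- by move=> x; apply: stopping_ge0.
- move=> A As; split; first exact: (greedy_density_gt0 gs).
  by move=> x; exact: (stoppingE Cs gs As).
- by move=> x; rewrite tE// => /unionP[A]; rewrite mem_filter => /andP[_ As] xA; exists A.
- move=> h; rewrite (greedy_sum Cs h gs); apply: eq_bigl => x.
  rewrite tE//; congr (_ \in union _); apply/esym/all_filterP/allP => A As.
  exact: (greedy_density_gt0 gs).
- move=> t A t0 At.
  apply: (greedy_admissible om (mass_set0 g) _ gs).
  + by [].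
  + move=> B Bs; apply: le_trans (hs B Bs) _; by rewrite mulr_ge0// outer_ge0.
  + by apply/subsetP => x xA; rewrite inE -tE// -leNgt At.
Qed.

Section StoppingTime.
Variables (g : T -> R) (s : seq {set T}) (tau : T -> R).
Hypotheses (g0 : forall x, 0 <= g x) (st : stopping_time g s tau).
Local Notation rho := (density nu (mass g)).

Lemma st_massE A : mass g A = rho A * nu A.
Proof. exact/densityK/mass_set0. Qed.

Lemma st_zero x : tau x <= 0 -> g x = 0.
Proof.
move=> tx; apply/eqP; rewrite eq_le g0 andbT.
have := st_mass st (A := [set x]) (lexx 0); rewrite mul0r /mass big_set1; apply.
by move=> y; rewrite inE => /eqP ->.
Qed.

Lemma st_sum_all (h : T -> R) : (forall x, tau x <= 0 -> h x = 0) ->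
  \sum_x h x = \sum_(A <- s) \sum_(x in A) h x.
Proof.
move=> h0; rewrite (st_sum st) [LHS](bigID (fun x => 0 < tau x))/= [X in _ + X]big1 ?addr0//.
by move=> x; rewrite -leNgt; exact: h0.
Qed.

Lemma st_superlevel t : 0 <= t ->
  nu [set x | t < tau x] <= \sum_(A <- s | t < rho A) nu A.
Proof.
move=> t0; apply: outer_bigcup => // x; rewrite inE => tx.
have [A As xA] := st_cover st (le_lt_trans t0 tx).
by exists A => //; rewrite xA andbT -(proj2 (st_mem st As) x xA).
Qed.

(** By [st_mass], the set where [tau] exceeds t is admissible at t. *)
Lemma level_mass_le t : 0 <= t ->
  level (mass g) nu t <= \sum_(A <- s | t < rho A) nu A.
Proof.
move=> t0; apply: le_trans (st_superlevel t0); apply/minval_le/admissibleP => A At.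
apply: (st_mass st) => // x /(subsetP At); by rewrite !inE -leNgt.
Qed.

(** Let [B] be optimal at t. A selected set of density above 2t has mass at most [t * nu A] off [B],
    hence at least [t * nu A] inside [B]. The cutoff at 4t puts this mass where [tau <= 4 * t], and
    there [st_mass] bounds the total by [4 * t * nu B]. *)
Lemma level_mass_ge t : 0 < t ->
  \sum_(A <- s | 2 * t < rho A <= 4 * t) nu A <= 4 * level (mass g) nu t.
Proof.
move=> t0.
rewrite /level; have [B /admissibleP Bt <-] := minval_attained nu (admissibleT om (mass_set0 g) t).
pose U := [set x in B | tau x <= 4 * t].
have cA A : A \in s -> 2 * t < rho A <= 4 * t ->
    t * nu A <= \sum_(x in A) g x * (x \in U)%:R.
  move=> As /andP[tA At].
  have -> : \sum_(x in A) g x * (x \in U)%:R = mass g [set x in A | x \in B].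
    rewrite big_mkcond [in RHS]/mass [RHS]big_mkcond; apply: eq_bigr => x _.
    rewrite !inE; case: ifPn => //= xA; rewrite (proj2 (st_mem st As) x xA) At andbT.
    by case: (x \in B); rewrite ?mulr1 ?mulr0.
  have h1 := mass_split g A (fun x => x \in B).
  have h2 : mass g [set x in A | x \notin B] <= t * nu A.
    apply: le_trans (Bt _ _) _; first by apply/subsetP => x; rewrite !inE => /andP[].
    by rewrite ler_pM2l// outer_mono//; apply/subsetP => x; rewrite !inE => /andP[].
  have h3 : 2 * t * nu A <= mass g A.
    by rewrite st_massE ler_wpM2r ?outer_ge0// ltW.
  by lra.
rewrite -(ler_pM2l t0) mulr_sumr.
have -> : t * (4 * nu B) = 4 * t * nu B by ring.
apply: (@le_trans _ _ (4 * t * nu U)); last first.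
  rewrite ler_pM2l ?mulr_gt0// outer_mono//.
  by apply/subsetP => x; rewrite !inE => /andP[].
have hU : mass g U <= 4 * t * nu U.
  by apply: (st_mass st); [rewrite mulr_ge0// ltW|move=> x; rewrite inE => /andP[]].
apply: le_trans hU.
rewrite [leLHS]big_seq_cond.
apply: le_trans (ler_sum _ (_ : forall A, _ -> _ <= \sum_(x in A) g x * (x \in U)%:R)) _.
  by move=> A /andP[As At]; exact: cA.
have -> : mass g U = \sum_x g x * (x \in U)%:R.
  rewrite /mass big_mkcond; apply: eq_bigr => x _.
  by case: ifP; rewrite ?mulr1 ?mulr0.
rewrite (st_sum_all (h := fun x => g x * (x \in U)%:R)); last first.
  by move=> x /st_zero ->; rewrite mul0r.
rewrite -big_seq_cond [leLHS]big_mkcond; apply: ler_sum => A _.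
by case: ifP => // _; apply: sumr_ge0 => x _; rewrite mulr_ge0.
Qed.

(** On a selected set [nu A * rho A] is the mass, so one power of the density is traded for
    summation against [g]. *)
Lemma st_weight theta : 0 < theta ->
  \sum_(A <- s) nu A * rho A `^ theta = \sum_x g x * tau x `^ (theta - 1).
Proof.
move=> th0; rewrite st_sum_all; last by move=> x /st_zero ->; rewrite mul0r.
rewrite [LHS]big_seq [RHS]big_seq; apply: eq_bigr => A As.
have [A0 tA] := st_mem st As.
transitivity (mass g A * rho A `^ (theta - 1)).
  by rewrite st_massE -(mulr_powRB1 (ltW A0) th0) mulrCA mulrA.
by rewrite /mass mulr_suml; apply: eq_bigr => x /tA ->.
Qed.

End StoppingTime.

(** Young's inequality for the product of u^theta and 1 with exponents 1/theta and 1/(1 - theta); at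
    theta = 1 the second exponent degenerates, and the claim is an equality. *)
Lemma bernoulli_powR (u theta : R) : 0 <= u -> 0 < theta -> theta <= 1 ->
  theta * (1 - u) <= 1 - u `^ theta.
Proof.
move=> u0 th0; rewrite le_eqVlt => /predU1P[->|th1]; first by rewrite powRr1// mul1r.
have := @conjugate_powR R (u `^ theta) 1 theta^-1 (1 - theta)^-1 (powR_ge0 _ _) ler01.
rewrite !invrK -powRrM divff ?gt_eqF// powRr1// powR1 mulr1 => /(_ _ _ _).
have -> : theta + (1 - theta) = 1 by ring.
rewrite !invr_gt0 subr_gt0 => /(_ th0 th1 erefl); lra.
Qed.

Lemma le0_powR_anti (x y a : R) : 0 < x -> x <= y -> a <= 0 -> y `^ a <= x `^ a.
Proof.
move=> x0 xy a0; rewrite -[a]opprK powRN [leRHS]powRN lef_pV2 ?posrE ?powR_gt0//.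
  by apply: ge0_ler_powR; rewrite ?oppr_ge0// nnegrE ltW// (lt_le_trans x0).
exact: lt_le_trans xy.
Qed.

(* Removing the points in decreasing order of [tau], each step is the
   tangent inequality for the concave function [u |-> u ^ (1 + a)]. *)
Lemma weighted_sum_powR (V : {set T}) (h tau : T -> R) (c a : R) :
  (forall x, 0 <= h x) -> (forall x, 0 <= tau x) -> 0 < c -> -1 < a -> a <= 0 ->
  (forall t, 0 <= t -> \sum_(x in V | tau x <= t) h x <= t * c) ->
  \sum_(x in V) h x * tau x `^ a <= c `^ (- a) * (\sum_(x in V) h x) `^ (1 + a) / (1 + a).
Proof.
move=> h0 tau0 c0 a1 a0.
have th0 : 0 < 1 + a by lra.
have [n] := ubnP #|V|; elim: n V => // n IH V; rewrite ltnS => Vn hV.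
have [/eqP V0|Vn0] := boolP (V == set0).
  by rewrite V0 !big_set0 powR0 ?gt_eqF// mulr0 mul0r.
have [x0 x0V] := set0Pn _ Vn0.
case: (@arg_maxP _ _ _ x0 [in V] tau x0V) => x xV xmax.
set tot := \sum_(y in V) h y.
have tot_le : tot <= tau x * c.
  apply: le_trans (hV _ (tau0 x)); rewrite le_eqVlt; apply/orP; left; apply/eqP.
  by apply: eq_bigl => y; case: (boolP (y \in V)) => //= yV; rewrite (xmax y yV : tau y <= _).
have tot0 : 0 <= tot by apply: sumr_ge0.
move: (tot0); rewrite le_eqVlt => /predU1P[tz|totp].
  rewrite big1 ?mulr_ge0 ?powR_ge0 ?invr_ge0 ?ltW// => y yV.
  by have /psumr_eq0P -> := esym tz; rewrite ?mul0r.
have totE : tot = h x + \sum_(y in V :\ x) h y by rewrite /tot (big_setD1 x).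
set b := \sum_(y in V :\ x) h y in totE.
have b0 : 0 <= b by apply: sumr_ge0.
rewrite (big_setD1 x)//=.
have IH' : \sum_(y in V :\ x) h y * tau y `^ a <= c `^ (- a) * b `^ (1 + a) / (1 + a).
  apply: IH.
    by rewrite (cardsD1 x) xV in Vn.
  move=> t t0; apply: le_trans (hV t t0); rewrite !big_mkcond [leRHS]big_mkcond/=.
  by apply: ler_sum => y _; rewrite !inE; case: eqP => //= _; case: ifP.
(* As x maximises [tau], the hypothesis at t = [tau x] controls all of [V], so [tau x] is at least
   [tot / c]; a negative power reverses this. *)
have tx : tau x `^ a <= tot `^ a * c `^ (- a).
  apply: le_trans (le0_powR_anti (x := tot / c) _ _ a0) _.
  - by rewrite divr_gt0.
  - by rewrite ler_pdivrMr.
  - by rewrite powRM ?invr_ge0 ?(ltW c0)// -(powR_inv1 (ltW c0)) -powRrM mulN1r.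
have key : h x * tot `^ a <= (tot `^ (1 + a) - b `^ (1 + a)) / (1 + a).
  rewrite ler_pdivlMr//.
  have hB : (1 + a) * (1 - b / tot) <= 1 - (b / tot) `^ (1 + a).
    by apply: bernoulli_powR; rewrite ?divr_ge0//; lra.
  have := ler_wpM2l (powR_ge0 tot (1 + a)) hB.
  rewrite [X in _ <= X]mulrBr mulr1 -powRM ?divr_ge0// (mulrC tot (b / tot)) divfK ?gt_eqF//.
  apply: le_trans; rewrite powRD ?gt_eqF ?implybT// powRr1//.
  rewrite (_ : h x = tot - b); last by rewrite totE addrK.
  rewrite le_eqVlt; apply/orP; left; apply/eqP; field.
  by rewrite gt_eqF.
apply: le_trans (lerD (ler_wpM2l (h0 x) tx) IH') _.
have -> : h x * (tot `^ a * c `^ (- a)) = c `^ (- a) * (h x * tot `^ a) by ring.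
rewrite -mulrA -mulrDr -mulrA ler_wpM2l ?powR_ge0//.
by apply: le_trans (lerD key (lexx _)) _; rewrite mulrBl subrK.
Qed.

Section Comparison.
Variables (g gi : T -> R) (s si : seq {set T}) (tau taui : T -> R).
Hypotheses (gi0 : forall x, 0 <= gi x) (gig : forall x, gi x <= g x).
Hypotheses (st : stopping_time g s tau) (sti : stopping_time gi si taui).

Let massi_le A : mass gi A <= mass g A.
Proof. exact: ler_sum. Qed.

(* On a selected set A with density T, [mass gi (A `&` {tau <= T/2}) <= T/2 nu A] is at
   most half the mass of A, so at least half of it sits where [tau > T/2]. *)
Lemma stopping_weight_ge0 a : 0 <= a ->
  \sum_x gi x * taui x `^ a <= 2 * 2 `^ a * \sum_x gi x * tau x `^ a.
Proof.
move=> a0.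
have zi x : taui x <= 0 -> gi x = 0 by exact: (st_zero gi0 sti).
rewrite !(st_sum_all sti); try by move=> x /zi ->; rewrite mul0r.
rewrite mulr_sumr [leLHS]big_seq [leRHS]big_seq; apply: ler_sum => A As.
have [T0 tA] := st_mem sti As; set t := density _ _ A in T0 tA.
have h1 := mass_split gi A (fun x => tau x <= t / 2).
set A1 := [set x in A | tau x <= t / 2] in h1.
set A2 := [set x in A | ~~ _] in h1.
have h2 : mass gi A1 <= t / 2 * nu A.
  apply: le_trans (massi_le _) _; apply: le_trans (st_mass st (t := t / 2) _ _) _.
  - by rewrite divr_ge0// ltW.
  - by move=> x; rewrite inE => /andP[].
  - apply: ler_wpM2l; first by rewrite divr_ge0// ltW.
    by apply: outer_mono => //; apply/subsetP => x; rewrite inE => /andP[].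
have h3 : mass gi A = t * nu A by exact: st_massE.
have h4 : mass gi A <= 2 * mass gi A2 by lra.
have -> : \sum_(x in A) gi x * taui x `^ a = mass gi A * t `^ a.
  by rewrite /mass mulr_suml; apply: eq_bigr => x /tA ->.
apply: le_trans (ler_wpM2r (powR_ge0 _ _) h4) _.
rewrite -!mulrA ler_pM2l// /mass mulr_suml mulr_sumr.
apply: (@le_trans _ _ (\sum_(x in A2) 2 `^ a * (gi x * tau x `^ a))).
  apply: ler_sum => x; rewrite inE -ltNge => /andP[xA tx].
  rewrite mulrCA ler_wpM2l// -powRM ?(st_ge0 st)//.
  apply: ge0_ler_powR => //.
  - exact: ltW T0.
  - by rewrite nnegrE mulr_ge0// (st_ge0 st).
  - by lra.
rewrite [leRHS](bigID (fun x => tau x <= t / 2))/= addrC.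
rewrite [X in _ <= X + _](eq_bigl [in A2]); last by move=> x; rewrite !inE.
by rewrite lerDl; apply: sumr_ge0 => x _; rewrite !mulr_ge0 ?powR_ge0.
Qed.

(** On a set [A] selected for [gi], of density t, the part where [tau <= u] has [gi]-mass at most
    [u * nu A]. Then [weighted_sum_powR] with c = [nu A] applies, and since the mass of [A] is
    [t * nu A], its bound is the mass times t^a / (1 + a). *)
Lemma stopping_weight_le0 a : -1 < a -> a <= 0 ->
  \sum_x gi x * tau x `^ a <= (1 + a)^-1 * \sum_x gi x * taui x `^ a.
Proof.
move=> a1 a0.
have zi x : taui x <= 0 -> gi x = 0 by exact: (st_zero gi0 sti).
rewrite !(st_sum_all sti); try by move=> x /zi ->; rewrite mul0r.
rewrite mulr_sumr [leLHS]big_seq [leRHS]big_seq; apply: ler_sum => A As.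
have [T0 tA] := st_mem sti As; set t := density _ _ A in T0 tA.
have nA : 0 < nu A by rewrite outer_gt0// (density_gt0_neq0 (mass_set0 gi) T0).
apply: le_trans (weighted_sum_powR (c := nu A) gi0 (st_ge0 st) nA a1 a0 _) _.
  move=> u u0; have -> : \sum_(x in A | tau x <= u) gi x = mass gi [set x in A | tau x <= u].
    by apply: eq_bigl => x; rewrite inE.
  apply: le_trans (ler_sum _ (fun x _ => gig x)) _.
  apply: le_trans (st_mass st u0 _) _; first by move=> x; rewrite inE => /andP[].
  by apply: ler_wpM2l => //; apply: outer_mono => //; apply/subsetP => x; rewrite inE => /andP[].
have -> : \sum_(x in A) gi x * taui x `^ a = mass gi A * t `^ a.
  by rewrite /mass mulr_suml; apply: eq_bigr => x /tA ->.
rewrite -/(mass gi A) mulrC ler_pM2l ?invr_gt0; last by lra.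
have th0 : 0 < 1 + a by lra.
have -> : mass gi A = t * nu A by exact: st_massE.
rewrite powRM ?(ltW T0) ?(ltW nA)// !powRD ?(gt_eqF T0) ?(gt_eqF nA) ?implybT//.
rewrite !powRr1 ?(ltW T0) ?(ltW nA)// powRN.
rewrite le_eqVlt; apply/orP; left; apply/eqP; field.
by rewrite gt_eqF// powR_gt0.
Qed.

End Comparison.

End Additive.
End Infimum.

(** * Layers, families of pieces and the canopy condition *)

Section Families.
Context {R : realType} {T : finType}.
Implicit Types (A B D U : {set T}) (m H : {set T} -> R).

(** The union of the sets where some [tau i] exceeds t is admissible at K t: off it, each
    [A :&: D i] has mass at most [t * nu (A :&: D i)], and these measures sum to at most
    [K * nu A]. *)
Lemma level_dilated (nu : {set T} -> R) (g : T -> R) (I : finType) (D : I -> {set T})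
    (s : I -> seq {set T}) (tau : I -> T -> R) (K t : R) :
  outer_meas nu -> (forall x, 0 <= g x) -> 0 <= t ->
  (forall x, exists i, x \in D i) ->
  (forall U, \sum_i nu (U :&: D i) <= K * nu U) ->
  (forall i, stopping_time nu (restr (D i) g) (s i) (tau i)) ->
  level (mass g) nu (K * t) <=
    \sum_i \sum_(A <- s i | t < density nu (mass (restr (D i) g)) A) nu A.
Proof.
move=> om g0 t0 cD hK st.
pose B := \bigcup_i [set x | t < tau i x].
have r0 i x : 0 <= restr (D i) g x by rewrite /restr; case: ifP.
apply: (@le_trans _ _ (nu B)).
  apply/minval_le/admissibleP => A AB.
  apply: (@le_trans _ _ (\sum_i mass (restr (D i) g) (A :&: D i))).
    rewrite /mass.
    under [leRHS]eq_bigr do rewrite big_mkcond.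
    rewrite exchange_big/= big_mkcond; apply: ler_sum => x _.
    case: ifPn => xA; last first.
      by apply: sumr_ge0 => i _; case: ifP.
    have [i xi] := cD x.
    rewrite (bigD1 i)//= inE xA xi /= {1}/restr xi lerDl.
    by apply: sumr_ge0 => j _; case: ifP.
  rewrite -mulrA (mulrC t) mulrA; apply: le_trans (ler_wpM2r t0 (hK A)).
  rewrite mulr_suml; apply: ler_sum => i _; rewrite mulrC.
  apply: (st_mass (st i)) => // x; rewrite inE => /andP[/(subsetP AB) + _].
  rewrite !inE leNgt; apply: contra => tx; apply/bigcupP; exists i => //.
  by rewrite inE.
apply: le_trans (outer_bigcup om (s := index_enum I) (Q := predT)
    (F := fun i => [set x | t < tau i x]) _) _.
  by move=> x /bigcupP[i _ xi]; exists i => //; rewrite mem_index_enum.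
apply: ler_sum => i _.
exact: (st_superlevel om (st i) t0).
Qed.

(** * Chains of exceptional sets at geometric levels *)

Section Chain.
Variables (m H : {set T} -> R) (Cov : {set T} -> {set T}) (Phi I : R).
Hypotheses (om : outer_meas m) (H0 : H set0 = 0) (Hge0 : forall A, 0 <= H A).
Hypothesis Phi_ge1 : 1 <= Phi.
Hypothesis mCov : forall A, m (Cov A) <= Phi * m A.
Hypothesis I_ge : forall (n : nat) (t : nat -> R),
  (forall k, 0 < t k) -> (forall k, t k.+1 <= t k) ->
  \sum_(k < n) (t k - t k.+1) * level H m (t k) <= I.

(** Here [I] dominates the lower Riemann sums of the integral of [level H m]; it will be the q-th
    power of the triple quasi-norm. The error e pays for stopping after finitely many levels. *)
Lemma level_chain e : 0 < e -> exists n (E : nat -> {set T}),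
  [/\ E 0%N = set0, E n = setT, (forall k, Cov (E k) \subset E k.+1) &
      \sum_(k < n) H (E k.+1 :\: E k) <= 8 * Phi * I + e].
Proof.
move=> e0; have Phi1 : 1 <= Phi := Phi_ge1.
(* [L] exceeds every density, so the empty set [E 0] is admissible at [t 0]. *)
pose L := 1 + \sum_(A : {set T}) density m H A.
have sr0 : 0 <= \sum_(A : {set T}) density m H A.
  by apply: sumr_ge0 => A _; apply: density_ge0.
have L0 : 0 < L by rewrite /L; lra.
have HL A : H A <= L * m A.
  rewrite (densityK om H0 A) ler_wpM2r ?outer_ge0// /L (bigD1 A)//= addrCA lerDl.
  by rewrite addr_ge0// sumr_ge0// => B _; apply: density_ge0.
pose M := 2 * Phi.
have M0 : 0 < M by rewrite /M; lra.
have Mi2 : M^-1 <= 2^-1 by rewrite lef_pV2 ?posrE// /M; lra.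
pose t k : R := L * M^-1 ^+ k.
have t0 k : 0 < t k by rewrite mulr_gt0// exprn_gt0// invr_gt0.
have tS k : t k = M * t k.+1 by rewrite /t exprS; field; rewrite gt_eqF.
have tS2 k : t k.+1 <= t k / 2.
  have -> : t k.+1 = t k * M^-1 by rewrite /t exprS; ring.
  by rewrite ler_wpM2l// ltW.
have Bex k := minval_attained m (admissibleT om H0 (t k)).
have [B HB] : exists B : nat -> {set T}, forall k,
    admissible H m (t k) (B k) /\ m (B k) = level H m (t k).
  have B_ex k : exists B, admissible H m (t k) B && (m B == level H m (t k)).
    by have [B Ba Bm] := Bex k; exists B; rewrite Ba Bm eqxx.
  exists (fun k => xchoose (B_ex k)) => k.
  by have /andP[? /eqP ?] := xchooseP (B_ex k).
pose E := fix E k := if k is k'.+1 then Cov (E k') :|: B k else set0.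
(* Since M^N >= 2^N >= N, this gives [t N * m setT <= e]: closing the chain with [setT] costs at
   most e. *)
pose N := (Num.truncn (L * m setT / e)).+1.
have tN : t N * m setT <= e.
  have hN : L * m setT / e <= N%:R.
    have x0 : 0 <= L * m setT / e by rewrite divr_ge0 ?mulr_ge0 ?outer_ge0// ltW.
    by case/andP: (truncn_itv x0) => _ /ltW.
  have h2 : M^-1 ^+ N <= N%:R^-1.
    rewrite exprVn lef_pV2 ?posrE ?exprn_gt0 ?ltr0n//.
    apply: (@le_trans _ _ (2 ^+ N)).
      by rewrite -natrX ler_nat ltnW// ltn_expl.
    by rewrite lerXn2r ?nnegrE ?(ltW M0)// /M; lra.
  rewrite /t mulrAC; apply: le_trans (ler_wpM2l _ h2) _.
    by rewrite mulr_ge0 ?outer_ge0// ltW.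
  by rewrite ler_pdivrMr ?ltr0n// (mulrC e) -ler_pdivrMr.
have mES k : m (E k.+1) <= Phi * m (E k) + level H m (t k.+1).
  rewrite -(HB k.+1).2.
  case: om => _ _ mU _; apply: le_trans (mU _ _) _.
  by rewrite lerD2r.
have HD k : H (E k.+1 :\: E k) <= t k * m (E k.+1 :\: E k).
  case: k => [|k]; first by rewrite {1}/t expr0 mulr1; exact: HL.
  apply: (admissibleP _ _ _ _ (HB k.+1).1); apply/subsetP => x.
  by rewrite !inE negb_or => /andP[/andP[_ ->]].
(* Weighted by [t], the loss [Phi] of an enlargement becomes a factor 1/2, because [t n] is 2 Phi
   times [t n.+1]. The extra last term on the left absorbs that half in the induction. *)
have sumE n : \sum_(k < n.+1) t k * m (E k) + t n * m (E n) <=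
    2 * \sum_(k < n.+1) t k * level H m (t k).
  elim: n => [|n IH].
    rewrite !big_ord1 /= outer0// !mulr0 addr0; apply: mulr_ge0 => //.
    by apply: mulr_ge0; [exact: ltW|exact: level_ge0].
  rewrite big_ord_recr [in leRHS]big_ord_recr/= -/(E n.+1).
  have h := ler_wpM2l (ltW (t0 n.+1)) (mES n).
  have h' : t n.+1 * (Phi * m (E n)) = t n * m (E n) / 2.
    by rewrite (tS n) /M; field.
  rewrite mulrDr h' in h; lra.
(* By [tS2], [t k] is at most twice the step [t k - t k.+1]. *)
have sumI n : \sum_(k < n) t k * level H m (t k) <= 2 * I.
  have := @I_ge n t t0; rewrite -(ler_pM2l (ltr0n R 2)).
  have tdec k : t k.+1 <= t k by have := tS2 k; have := t0 k; lra.
  move=> /(_ tdec); apply: le_trans; rewrite mulr_sumr; apply: ler_sum => k _.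
  rewrite mulrA ler_wpM2r ?level_ge0//; have := tS2 k; lra.
exists N.+1, (fun k => if (k <= N)%N then E k else setT); split => //.
- by rewrite ltnn.
- move=> k; case: ltnP => kN; last by rewrite subsetT.
  by rewrite ltnW//= subsetUl.
rewrite big_ord_recr/= leqnn ltnn; apply: lerD; last first.
  apply: le_trans tN.
  have : H (setT :\: E N) <= t N * m (setT :\: E N).
    apply: (admissibleP _ _ _ _ (HB N).1); rewrite /N/= setTD setCS.
    by rewrite subsetUr.
  move=> /le_trans; apply; rewrite ler_pM2l//; apply: outer_mono => //.
(* A layer is tested at [t k] but lies in [E k.+1], whose weight is [t k.+1]; this costs [M]. With a
   factor 2 from each of [sumE] and [sumI] the constant is 4 M = 8 Phi. *)
apply: (@le_trans _ _ (M * \sum_(k < N.+1) t k * m (E k))).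
  rewrite [X in _ <= M * X]big_ord_recl /= outer0// mulr0 add0r mulr_sumr; apply: ler_sum => k _.
  rewrite ltn_ord ltnW// mulrA /bump /= -tS; apply: le_trans (HD k) _.
  by rewrite ler_pM2l//; apply: outer_mono => //; exact: subsetDl.
have h1 := sumE N; have h2 := sumI N.+1.
have h3 : 0 <= t N * m (E N) by rewrite mulr_ge0 ?outer_ge0// ltW.
have -> : 8 * Phi * I = M * (4 * I) by rewrite /M; ring.
by rewrite ler_pM2l//; lra.
Qed.

End Chain.

Section Caratheodory.
Variables (mu nu : {set T} -> R) (C : {set T} -> {set {set T}}) (Phi K : R).
Hypotheses (onu : outer_meas nu) (hC : canopy mu nu C Phi K).
Let Cov A := cover (C A).

Lemma canopy_sub A : A \subset Cov A.
Proof. by case: hC => -[]. Qed.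

Lemma canopy_mono A B : A \subset B -> Cov A \subset Cov B.
Proof. by case: hC => -[_ _ _ h _]; exact: h. Qed.

Lemma canopy_mu A : mu (Cov A) <= Phi * mu A.
Proof. by case: hC => -[_ _ h _ _]; exact: h. Qed.

Lemma carath_add (P : {set {set T}}) D U : carath nu K P ->
  D \subset ~: Cov (cover P) ->
  carath nu K (D |: P) /\
  \sum_(A in D |: P) nu (U :&: A) = nu (U :&: D) + \sum_(A in P) nu (U :&: A).
Proof.
move=> cP dD; split; first by case: hC => _; apply => //; rewrite disjoints_subset.
(* [D] can already belong to [P] only if it is empty, and then it contributes nothing to the sum. *)
have [DP|DP] := boolP (D \in P); last by rewrite big_setU1.
have -> : D |: P = P by apply/setUidPr; rewrite sub1set.
suff -> : D = set0 by rewrite setI0 outer0// add0r.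
apply/eqP; rewrite -subset0; apply/subsetP => x xD.
have := subsetP dD _ xD; rewrite inE => /negP[].
by apply: (subsetP (canopy_sub _)); apply/bigcupP; exists D.
Qed.

Lemma carath0 : carath nu K set0.
Proof.
split; first by apply/trivIsetP => A B; rewrite inE.
by move=> U; rewrite big_set0 /cover big_set0 setI0 outer0// mulr0.
Qed.

(** Induction in the order of selection: each new set avoids the canopy of the union of the earlier
    ones, which is what the canopy condition asks for. *)
Lemma greedy_carath m H s U : 1 <= K -> greedy m H Cov s ->
  \sum_(A <- s) nu (U :&: A) <= K * nu U.
Proof.
move=> K1 gs.
suff [cs -> _] : [/\ carath nu K [set A in s],
    \sum_(A <- s) nu (U :&: A) = \sum_(A in [set A in s]) nu (U :&: A) &
    cover [set A in s] = union s].
  case: cs => _ /(_ U)/le_trans; apply; rewrite ler_wpM2l//; first by lra.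
  by apply: outer_mono => //; exact: subsetIl.
elim: s gs => [_|A s IH [dA _ _ /IH [cs sE cE]]].
  have -> : [set A in [::]] = set0 :> {set {set T}} by apply/setP => A; rewrite !inE.
  by rewrite big_set0 big_nil /cover big_set0 /union big_nil; split => //; exact: carath0.
rewrite set_cons; have [|c e] := @carath_add [set A in s] A U cs.
  by rewrite cE.
split => //; first by rewrite big_cons e sE.
by rewrite /cover bigcup_setU big_set1 union_cons -cE.
Qed.

(* [E k.+1] contains the canopy of [E k], so the layers [E k.+1 :\: E k] with [k] of a
   given parity are added outside the canopy of the previous ones. *)
Lemma layers_carath (E : nat -> {set T}) n U : 1 <= K ->
  (forall k, Cov (E k) \subset E k.+1) ->
  \sum_(k < n) nu (U :&: (E k.+1 :\: E k)) <= 2 * K * nu U.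
Proof.
move=> K1 hE.
pose D k := E k.+1 :\: E k.
have Emono k : E k \subset E k.+1 by apply: subset_trans (hE k); exact: canopy_sub.
(* [S k] sums every second layer, from index k - 1 downwards, so two consecutive values of [S] make
   up the full sum. The induction on [Q] runs in steps of two accordingly. *)
pose S := fix S k := match k with
  | 0%N => 0 | 1%N => nu (U :&: D 0%N) | (k'.+1 as k1).+1 => nu (U :&: D k1) + S k' end.
pose Q k := exists P, [/\ carath nu K P, S k = \sum_(A in P) nu (U :&: A) & cover P \subset E k].
have cS k : Q k /\ Q k.+1.
  elim: k => [|k [[P [cP SP PE]] IH]]; split => //.
  - exists set0; rewrite /S big_set0 /cover big_set0 sub0set.
    by split => //; exact: carath0.
  - exists [set D 0%N]; rewrite big_set1 /cover big_set1 subsetDl; split => //.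
    split; first by apply/trivIsetP => A B; rewrite !inE => /eqP-> /eqP->; rewrite eqxx.
    move=> V; rewrite big_set1 /cover big_set1.
    by rewrite -[leLHS]mul1r ler_wpM2r// outer_ge0.
  - have [|c e] := @carath_add P (D k.+1) U cP.
      apply/subsetP => x; rewrite !inE => /andP[xE _]; apply: contra xE => xC.
      by apply: (subsetP (hE k)); apply: (subsetP (canopy_mono PE)).
    exists (D k.+1 |: P); split => //; first by rewrite e -SP.
    rewrite /cover bigcup_setU big_set1 subUset subsetDl /=.
    by apply: subset_trans PE _; apply: subset_trans (Emono _) (Emono _).
have SK i : S i <= K * nu U.
  have [P [[_ /(_ U) h] -> _]] := (cS i).1; apply: le_trans h _.
  rewrite ler_wpM2l//; first by lra.
  by apply: outer_mono => //; exact: subsetIl.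
case: n => [|n]; first by rewrite big_ord0 !mulr_ge0 ?outer_ge0//; lra.
have -> : \sum_(k < n.+1) nu (U :&: D k) = S n.+1 + S n.
  elim: n => [|n IH]; first by rewrite big_ord1 addr0.
  by rewrite big_ord_recr/= IH addrAC -/(S n.+1) [RHS]addrAC; congr (_ + _); rewrite addrC.
by apply: le_trans (lerD (SK n.+1) (SK n)) _; rewrite -mulrA mulr_natl mulr2n.
Qed.

End Caratheodory.
Lemma mass_restr (g : T -> R) A B : mass (restr A g) B = mass g (B :&: A).
Proof.
rewrite /mass big_mkcond [RHS]big_mkcond; apply: eq_bigr => x _.
by rewrite inE /restr; case: (x \in B).
Qed.

Lemma level_mass0 (nu : {set T} -> R) (g : T -> R) t : outer_meas nu -> 0 <= t ->
  (forall x, g x = 0) -> level (mass g) nu t = 0.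
Proof.
move=> om t0 gz; apply/eqP; rewrite eq_le level_ge0 ?mass_set0// andbT.
rewrite -(outer0 om); apply/minval_le/admissibleP => A _.
by rewrite /mass big1// mulr_ge0 ?outer_ge0.
Qed.

Section Pieces.
Variables (nu : {set T} -> R) (s : seq {set T}) (K : R).
Hypotheses (onu : outer_meas nu)
  (hs : forall U, \sum_(A <- s) nu (U :&: A) <= K * nu U).

(** If [B] is optimal for [g], then [B :&: A] is admissible for the restriction of [g] to [A]. *)
Lemma level_pieces (g : T -> R) t : 0 <= t ->
  \sum_(A <- s) level (mass (restr A g)) nu t <= K * level (mass g) nu t.
Proof.
move=> t0; rewrite [in leRHS]/level.
have [B /admissibleP Bt <-] := minval_attained nu (admissibleT onu (mass_set0 g) t).
apply: le_trans (hs B); apply: ler_sum => A _.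
apply/minval_le/admissibleP => D DB; rewrite mass_restr.
apply: (@le_trans _ _ (t * nu (D :&: A))).
  apply: Bt; apply/subsetP => x; rewrite !inE => /andP[/(subsetP DB)].
  by rewrite !inE => /nandP[//|/negPf ->].
by rewrite ler_wpM2l//; apply: outer_mono => //; exact: subsetIl.
Qed.

Definition exceed (f : T -> R) (l : R) : {set T} := [set x | l < `|f x|].

Lemma exceed_restr f l A : 0 <= l -> exceed (restr A f) l = exceed f l :&: A.
Proof.
move=> l0; apply/setP => x; rewrite !inE /restr; case: (x \in A); rewrite ?andbT//.
by rewrite normr0 andbF ltNge l0.
Qed.

Lemma exceed_pieces f l : 0 <= l ->
  \sum_(A <- s) nu (exceed (restr A f) l) <= K * nu (exceed f l).
Proof.
move=> l0; apply: le_trans (hs _); apply: ler_sum => A _.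
by rewrite exceed_restr.
Qed.

End Pieces.

Lemma exceed_cover (nu : {set T} -> R) (I : finType) (D : I -> {set T}) f l :
  outer_meas nu -> 0 <= l -> (forall x, exists i, x \in D i) ->
  nu (exceed f l) <= \sum_i nu (exceed (restr (D i) f) l).
Proof.
move=> om l0 cD; apply: outer_bigcup => // x xf.
have [i xi] := cD x; exists i; first by rewrite mem_index_enum.
by rewrite exceed_restr// inE xf xi.
Qed.

Lemma layers_cover (E : nat -> {set T}) n : E 0%N = set0 -> E n = setT ->
  forall x, exists i : 'I_n, x \in E i.+1 :\: E i.
Proof.
move=> E0 En x.
have ex : exists k, x \in E k by exists n; rewrite En inE.
case: (ex_minnP ex) => -[|k] xk kmin; first by rewrite E0 inE in xk.
have kn : (k < n)%N by apply: kmin; rewrite En inE.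
exists (Ordinal kn) => /=; rewrite inE xk andbT; apply/negP => /kmin.
by rewrite ltnn.
Qed.

(** The half-open intervals are disjoint, so at most one term survives, and there monotonicity
    compares [L (t k)] with [L u]. *)
Lemma sum_steps_le (L : R -> R) (t : nat -> R) n (u : R) :
  (forall x y, x <= y -> L y <= L x) -> (forall x, 0 <= L x) ->
  (forall k, t k.+1 <= t k) ->
  \sum_(k < n) L (t k) * (t k.+1 <= u < t k)%R%:R <= L u.
Proof.
move=> Lni L0 tdec.
have tmono i j : (i <= j)%N -> t j <= t i.
  by move=> /subnK <-; elim: (j - i)%N => // k; rewrite addSn; exact: le_trans.
have [/existsP[k /andP[k1 k2]]|/existsPn no] :=
    boolP [exists k : 'I_n, t k.+1 <= u < t k]; last first.
  by rewrite big1// => k _; rewrite (negPf (no k)) mulr0.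
rewrite (bigD1 k)//= k1 k2 mulr1 big1 ?addr0; first exact/Lni/ltW.
move=> j jk; case: (boolP (_ && _)); rewrite ?mulr0// => /andP[j1 j2].
case: (ltngtP j k) => [jk'|jk'|jk'].
- by have := le_lt_trans (le_trans (tmono _ _ jk') j1) k2; rewrite ?ltxx => //.
- by have := le_lt_trans (le_trans (tmono _ _ jk') k1) j2; rewrite ltxx.
- by move: jk; rewrite -val_eqE /= jk' eqxx.
Qed.

End Families.

From mathcomp Require Import all_classical all_reals.
From mathcomp Require Import ereal normedtype sequences.
From mathcomp Require Import derive realfun measurable_realfun ftc.
From mathcomp Require Import numfun exp measure lebesgue_measure lebesgue_integral.
Import Order.TTheory GRing.Theory Num.Theory.
Import numFieldNormedType.Exports.
Local Open Scope ring_scope.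

(** * The integrals defining the quasi-norms *)

Section WeightedIntegral.
Context {R : realType}.
Implicit Types (p a b : R) (L : R -> R).

Notation mu := (@lebesgue_measure R).
Notation Rpos := (`]0%R, +oo[%classic : set R).

Lemma integral_power_itv p a b : 0 < a -> a < b ->
  (\int[mu]_(l in `[a, b]) (p * l `^ (p - 1))%:E = (b `^ p - a `^ p)%:E)%E.
Proof.
move=> a0 ab.
have pos x : x \in `[a, b] -> 0 < x.
  by rewrite in_itv/= => /andP[ax _]; exact: lt_le_trans ax.
have cts (s x : R) : 0 < x -> {for x, continuous (fun l => l `^ s)}.
  move=> x0; apply/differentiable_continuous/derivable1_diffP.
  exact: (@ex_derive _ _ _ _ _ _ _ (is_derive1_powR s x0)).
rewrite (@continuous_FTC2 _ _ (fun l => l `^ p)) ?EFinB//.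
- apply: continuous_in_subspaceT => x /set_mem /= /pos x0.
  by apply: cvgM; [exact: cvg_cst|exact: cts].
- split.
  + move=> x; rewrite in_itv/= => /andP[ax _]; apply: derivable_powR.
    by rewrite in_itv/= andbT; exact: lt_trans ax.
  + by apply: cvg_at_right_filter; exact: cts.
  + by apply: cvg_at_left_filter; apply: cts; exact: lt_trans ab.
- move=> x; rewrite in_itv/= => /andP[ax _]; apply: powR_derive1.
  by rewrite in_itv/= andbT; exact: lt_trans ax.
Qed.

Lemma measurable_power p (D : set R) :
  measurable_fun D (fun l : R => (p * l `^ (p - 1))%:E).
Proof.
apply/measurable_EFinP; apply: measurable_funM => //.
by apply: (measurable_funS measurableT) => //; exact: measurable_powR.
Qed.

(** For p < 1 the integrand is singular at 0, so the fundamental theorem is used on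
    [b / (n + 2), b], followed by monotone convergence. *)
Lemma integral_power0 p b : 0 < p -> 0 < b ->
  (\int[mu]_(l in `]0%R, b]) (p * l `^ (p - 1))%:E = (b `^ p)%:E)%E.
Proof.
move=> p0 b0.
pose F (n : nat) : set R := `[b * n.+2%:R^-1, b]%classic.
have Fn n : 0 < b * n.+2%:R^-1 < b.
  by rewrite mulr_gt0//= gtr_pMr// invf_lt1// ltr1n.
have -> : `]0, b]%classic = (\bigcup_n F n)%classic.
  apply/seteqP; split => [x/=|x [n _]]; rewrite /F/= !in_itv/=.
    move=> /andP[x0 xb].
    exists (Num.truncn (b / x)) => //=.
    rewrite in_itv/= xb andbT ler_pdivrMr// mulrC -ler_pdivrMr//.
    have /andP[_ /ltW] := truncn_itv (ltW (divr_gt0 b0 x0)).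
    by move=> /le_trans; apply; rewrite ler_nat.
  by move=> /andP[+ ->]; rewrite andbT; apply: lt_le_trans; case/andP: (Fn n).
have ndF : nondecreasing_seq F.
  apply/nondecreasing_seqP => n; rewrite subsetEset => x /=.
  rewrite /F/= !in_itv/= => /andP[+ ->]; rewrite andbT; apply: le_trans.
  by rewrite ler_pM2l// lef_pV2 ?posrE// ler_nat.
have := @ge0_nondecreasing_set_cvg_integral _ (measurableTypeR R) R F
  (fun l => (p * l `^ (p - 1))%:E) lebesgue_measure ndF.
move=> /(_ _ _ _)/cvg_lim <-//; last 3 first.
- by move=> n; exact: measurable_itv.
- by move=> n; exact: measurable_power.
- by move=> n x _; rewrite lee_fin mulr_ge0 ?powR_ge0// ltW.
apply/cvg_lim => //.
rewrite (_ : (fun n => _) = (fun n => (b `^ p - (b * n.+2%:R^-1) `^ p)%:E)); last first.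
  by apply/funext => n; rewrite integral_power_itv//; case/andP: (Fn n).
apply/cvg_EFin; first by exists 0%N.
rewrite -[X in (_ --> X)%classic]subr0.
apply: cvgB; first exact: cvg_cst.
have h1 : ((b * n.+2%:R^-1) @[n --> \oo] --> (0 : R))%classic.
  rewrite -(mulr0 b); apply: cvgM; first exact: cvg_cst.
  have := @cvg_harmonic R; rewrite -cvg_shiftS; exact.
have := @powR_cvg0 R p p0 => /(_ _).
move/cvg_at_rightP; apply; split => // n.
by case/andP: (Fn n).
Qed.

Definition wint p L : \bar R :=
  (\int[mu]_(l in `]0%R, +oo[) ((p * l `^ (p - 1))%:E * (L l)%:E))%E.

Lemma wint_itv p a b : 0 < p -> 0 <= a -> a <= b ->
  wint p (fun l => (a <= l < b)%R%:R) = (b `^ p - a `^ p)%:E.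
Proof.
move=> p0 a0; rewrite le_eqVlt => /predU1P[<-|ab].
  rewrite subrr; apply: integral0_eq => l _.
  by rewrite (_ : _ && _ = false) ?mule0//; apply/negP => /andP[]; rewrite leNgt => /negP.
have eqD (D : set R) : D = (`]0%R, +oo[ `&` `[a, b[)%classic -> measurable D ->
    wint p (fun l => (a <= l < b)%R%:R) = (\int[mu]_(l in D) (p * l `^ (p - 1))%:E)%E.
  move=> -> mD; rewrite integral_mkcondr; apply: eq_integral => l _.
  rewrite patchE mem_setE in_itv/=; case: ifP => _; first by rewrite mule1.
  by rewrite mule0.
move: a0; rewrite le_eqVlt => /predU1P[a0|a0].
  subst a.
  rewrite (eqD `]0%R, b[%classic) //; last first.
    apply/seteqP; split => x /=; rewrite !in_itv/= andbT.
      by move=> /andP[x0 ->]; rewrite x0 (ltW x0).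
    by move=> [-> /andP[_ ->]].
  rewrite powR0 ?gt_eqF// subr0 -integral_power0//.
  by apply: integral_itv_bndo_bndc; exact: measurable_power.
rewrite (eqD `[a, b[%classic) //; last first.
  apply/seteqP; split => x /=; rewrite !in_itv/= andbT.
    by move=> /andP[xa ->]; rewrite xa (lt_le_trans a0 xa).
  by move=> [_ ->].
rewrite -integral_power_itv //.
by apply: integral_itv_bndo_bndc; exact: measurable_power.
Qed.

Definition noninc_pos L := (forall l : R, 0 < l -> 0 <= L l) /\
  (forall l l' : R, 0 < l -> l <= l' -> L l' <= L l).

(** Monotonicity is known only on the positive half-line; composing with exp(-x) yields a monotone
    function on the whole line, and -ln brings it back. *)
Lemma noninc_pos_measurable L : noninc_pos L -> measurable_fun Rpos L.
Proof.
move=> [L0 Lni].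
pose f (x : R) := expR (- x).
have mf : measurable_fun [set: R] (L \o f).
  rewrite (_ : L \o f = -%R \o (-%R \o (L \o f))); last by apply/funext => x /=; rewrite opprK.
  apply: measurableT_comp => //; apply: nonincreasing_measurable => // x y xy /=.
  by rewrite lerN2; apply: Lni; rewrite ?expR_gt0// /f ler_expR lerN2.
apply: (@eq_measurable_fun _ _ _ _ _ ((L \o f) \o (fun x : R => - ln x))).
  move=> x; rewrite inE/= in_itv/= andbT => x0.
  by rewrite /f opprK lnK.
apply: measurable_funTS; apply: measurableT_comp => //.
by apply: measurableT_comp => //; exact: measurable_ln.
Qed.

Lemma wint_measurable p L : measurable_fun Rpos L ->
  measurable_fun Rpos (fun l => (p * l `^ (p - 1))%:E * (L l)%:E)%E.
Proof.
by move=> mL; apply: emeasurable_funM; [exact: measurable_power|exact/measurable_EFinP].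
Qed.

Lemma wint_ge0 p L : 0 < p -> (forall l : R, 0 < l -> 0 <= L l) -> (0 <= wint p L)%E.
Proof.
move=> p0 L0; apply: integral_ge0 => l; rewrite /= in_itv/= andbT => l0.
by rewrite lee_fin mulr_ge0 ?L0// mulr_ge0 ?powR_ge0// ltW.
Qed.

Lemma le_wint p L (M : R -> R) : 0 < p ->
  measurable_fun Rpos L -> measurable_fun Rpos M ->
  (forall l : R, 0 < l -> 0 <= L l) -> (forall l : R, 0 < l -> L l <= M l) ->
  (wint p L <= wint p M)%E.
Proof.
move=> p0 mL mM L0 LM; apply: ge0_le_integral => //.
- move=> l; rewrite /= in_itv/= andbT => l0.
  by rewrite lee_fin mulr_ge0 ?L0// mulr_ge0 ?powR_ge0// ltW.
- exact: wint_measurable.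
- exact: wint_measurable.
- move=> l; rewrite /= in_itv/= andbT => l0.
  by rewrite lee_fin ler_wpM2l ?LM// mulr_ge0 ?powR_ge0// ltW.
Qed.

Lemma wint_sum p (I : Type) (s : seq I) (M : I -> R -> R) : 0 < p ->
  (forall i, measurable_fun Rpos (M i)) ->
  (forall i l, 0 < l -> 0 <= M i l) ->
  wint p (fun l => \sum_(i <- s) M i l) = (\sum_(i <- s) wint p (M i))%E.
Proof.
move=> p0 mM M0; rewrite /wint -ge0_integral_sum //.
- apply: eq_integral => l; rewrite inE/= in_itv/= andbT => l0.
  by rewrite -sumEFin ge0_sume_distrr// => i _; rewrite lee_fin M0.
- by move=> i; exact: wint_measurable.
- move=> i l; rewrite /= in_itv/= andbT => l0.
  by rewrite lee_fin mulr_ge0 ?M0// mulr_ge0 ?powR_ge0// ltW.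
Qed.

Lemma wintZ p (c : R) (M : R -> R) : 0 < p -> 0 <= c -> measurable_fun Rpos M ->
  (forall l : R, 0 < l -> 0 <= M l) ->
  wint p (fun l => c * M l) = (c%:E * wint p M)%E.
Proof.
move=> p0 c0 mM M0; rewrite /wint -ge0_integralZl_EFin //.
- by apply: eq_integral => l _; rewrite EFinM muleCA.
- move=> l; rewrite /= in_itv/= andbT => l0.
  by rewrite lee_fin mulr_ge0 ?M0// mulr_ge0 ?powR_ge0// ltW.
- exact: wint_measurable.
Qed.

Lemma measurable_step a b : measurable_fun Rpos (fun l => (a <= l < b)%R%:R : R).
Proof.
apply: measurable_funTS.
rewrite (_ : (fun _ => _) = indic `[a, b[%classic); first exact: measurable_indic.
by apply/funext => l; rewrite indicE mem_setE in_itv.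
Qed.

Lemma measurable_steps (I : Type) (s : seq I) (a b c : I -> R) :
  measurable_fun Rpos (fun l => \sum_(i <- s) c i * (a i <= l < b i)%R%:R).
Proof.
apply: measurable_sum => i.
by apply: measurable_funM => //; exact: measurable_step.
Qed.

Lemma wint_steps p (I : Type) (s : seq I) (a b c : I -> R) : 0 < p ->
  (forall i, 0 <= c i) -> (forall i, 0 <= a i) -> (forall i, a i <= b i) ->
  wint p (fun l => \sum_(i <- s) c i * (a i <= l < b i)%R%:R) =
  (\sum_(i <- s) c i * (b i `^ p - a i `^ p))%:E.
Proof.
move=> p0 c0 a0 ab.
rewrite wint_sum//; last 2 first.
- by move=> i; apply: measurable_funM => //; exact: measurable_step.
- by move=> i l _; rewrite mulr_ge0.
rewrite -sumEFin; apply: eq_bigr => i _.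
by rewrite wintZ//; [rewrite wint_itv|exact: measurable_step].
Qed.

Lemma wint_ge_steps p L (I : Type) (s : seq I) (a b c : I -> R) : 0 < p ->
  noninc_pos L ->
  (forall i, 0 <= c i) -> (forall i, 0 <= a i) -> (forall i, a i <= b i) ->
  (forall l : R, 0 < l -> \sum_(i <- s) c i * (a i <= l < b i)%R%:R <= L l) ->
  ((\sum_(i <- s) c i * (b i `^ p - a i `^ p))%:E <= wint p L)%E.
Proof.
move=> p0 Lni c0 a0 ab sL; rewrite -wint_steps//.
apply: le_wint => //.
- exact: measurable_steps.
- exact: noninc_pos_measurable.
- by move=> l _; apply: sumr_ge0 => i _; rewrite mulr_ge0.
Qed.

Lemma wint_le_steps p L (I : Type) (s : seq I) (b c : I -> R) : 0 < p ->
  noninc_pos L -> (forall i, 0 <= c i) -> (forall i, 0 <= b i) ->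
  (forall l : R, 0 < l -> L l <= \sum_(i <- s) c i * (l < b i)%R%:R) ->
  (wint p L <= (\sum_(i <- s) c i * b i `^ p)%:E)%E.
Proof.
move=> p0 Lni c0 b0 sL.
have -> : \sum_(i <- s) c i * b i `^ p = \sum_(i <- s) c i * (b i `^ p - 0 `^ p).
  by apply: eq_bigr => i _; rewrite powR0 ?gt_eqF// subr0.
rewrite -(@wint_steps p I s (fun=> 0))//.
apply: le_wint => //.
- exact: noninc_pos_measurable.
- exact: measurable_steps.
- by case: Lni.
- move=> l l0; apply: le_trans (sL l l0) _; rewrite le_eqVlt; apply/orP; left.
  by apply/eqP; apply: eq_bigr => i _; rewrite (ltW l0).
Qed.

End WeightedIntegral.

Section Powers.
Context {R : realType}.
Implicit Types x y p : R.

Lemma powRVK p x : 0 < p -> 0 <= x -> (x `^ p^-1) `^ p = x.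
Proof. by move=> p0 x0; rewrite -powRrM mulVf ?gt_eqF// powRr1. Qed.

Lemma ltr_powR_inv p x y : 0 < p -> 0 <= x -> 0 <= y -> (x < y `^ p^-1) = (x `^ p < y).
Proof.
move=> p0 x0 y0; apply/idP/idP => h.
  rewrite -[ltRHS](powRVK p0 y0); apply: gt0_ltr_powR; rewrite ?nnegrE ?powR_ge0//.
rewrite ltNge; apply/negP => h'.
have h2 : y <= x `^ p.
  by rewrite -[leLHS](powRVK p0 y0); apply: ge0_ler_powR; rewrite ?nnegrE ?powR_ge0 ?(ltW p0).
by move: h; rewrite ltNge h2.
Qed.

Lemma ler_powR_inv p x y : 0 < p -> 0 <= x -> 0 <= y -> (y `^ p^-1 <= x) = (y <= x `^ p).
Proof. by move=> p0 x0 y0; rewrite !leNgt ltr_powR_inv. Qed.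

Lemma ler_powR_root p x y : 0 < p -> 0 <= x -> 0 <= y -> x <= y -> x `^ p^-1 <= y `^ p^-1.
Proof. by move=> p0 x0 y0 xy; apply: ge0_ler_powR; rewrite ?invr_ge0 ?nnegrE ?(ltW p0). Qed.

End Powers.

(** * The double quasi-norm as a weighted sum along a stopping time *)

Section AdditiveNorm.
Context {R : realType} {T : finType}.
Variables (nu : {set T} -> R) (q r : R).
Hypotheses (om : outer_meas nu) (q0 : 0 < q) (r0 : 0 < r).
Implicit Types g : T -> R.

Local Notation theta := (q / r).
Local Notation lvl g := (fun l => level (mass g) nu (l `^ r)).
Let theta0 : 0 < theta. Proof. exact: divr_gt0. Qed.

Lemma level_noninc_pos (H : {set T} -> R) (m : {set T} -> R) p :
  outer_meas m -> H finset.set0 = 0 -> 0 < p -> noninc_pos (fun l => level H m (l `^ p)).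
Proof.
move=> om' H0 p0; split => [l _|l l' l0 ll']; first exact: level_ge0.
apply: level_noninc => //; apply: ge0_ler_powR; rewrite ?nnegrE ?(ltW p0) ?(ltW l0)//.
exact: le_trans (ltW l0) ll'.
Qed.

Section Weight.
Variables (g : T -> R) (s : seq {set T}) (tau : T -> R).
Hypotheses (g0 : forall x, 0 <= g x) (st : stopping_time nu g s tau).
Local Notation rho := (density nu (mass g)).

Let rho0 A : 0 <= rho A.
Proof. by apply: density_ge0 => // B; exact: mass_ge0. Qed.

Let rho_pow A : (rho A `^ r^-1) `^ q = rho A `^ theta.
Proof. by rewrite -powRrM mulrC. Qed.

(** Integrates [level_mass_le]: a selected set counts [nu A] up to height rho^(1/r), hence
    contributes [nu A] times rho^theta. *)
Lemma wint_level_le : (wint q (lvl g) <= (\sum_x g x * tau x `^ (theta - 1))%:E)%E.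
Proof.
rewrite -(st_weight om g0 st theta0).
under eq_bigr do rewrite -rho_pow.
apply: wint_le_steps => //.
- exact: level_noninc_pos om (mass_set0 g) r0.
- by move=> A; exact: outer_ge0.
- by move=> A; exact: powR_ge0.
move=> l l0; apply: le_trans (level_mass_le om st (powR_ge0 _ _)) _.
rewrite big_mkcond; apply: ler_sum => A _.
by rewrite -(ltr_powR_inv r0 (ltW l0))//; case: ifP => _; rewrite ?mulr1 ?mulr0.
Qed.

(** The factor 1/4 is the loss in [level_mass_ge]; there a selected set is counted for rho/4 <= l^r
    < rho/2, and integrating over this range produces the difference of powers. *)
Definition weight_const : R := 4^-1 * (2^-1 `^ theta - 4^-1 `^ theta).

Lemma weight_const_gt0 : 0 < weight_const.
Proof.
rewrite mulr_gt0// ?invr_gt0// subr_gt0; apply: gt0_ltr_powR; rewrite ?nnegrE ?invr_ge0//.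
by rewrite ltf_pV2 ?posrE//; lra.
Qed.

Lemma wint_level_ge :
  ((weight_const * \sum_x g x * tau x `^ (theta - 1))%:E <= wint q (lvl g))%E.
Proof.
rewrite -(st_weight om g0 st theta0) mulr_sumr.
rewrite (eq_bigr (fun A => (4^-1 * nu A) *
   (((rho A / 2) `^ r^-1) `^ q - ((rho A / 4) `^ r^-1) `^ q))); last first.
  move=> A _; rewrite -!powRrM (mulrC r^-1) !(powRM _ (rho0 A)) ?invr_ge0// /weight_const; ring.
apply: wint_ge_steps => //.
- exact: level_noninc_pos om (mass_set0 g) r0.
- by move=> A; rewrite mulr_ge0 ?invr_ge0 ?outer_ge0.
- by move=> A; exact: powR_ge0.
- move=> A; apply: ler_powR_root => //; [exact: divr_ge0|exact: divr_ge0|].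
  by rewrite ler_wpM2l// lef_pV2 ?posrE//; lra.
move=> l l0.
have t0 : 0 < l `^ r by exact: powR_gt0.
have := level_mass_ge om g0 st t0.
rewrite -ler_pdivrMl// mulr_sumr; apply: le_trans.
rewrite [leRHS]big_mkcond; apply: ler_sum => A _.
have h4 : 0 <= rho A / 4 by exact: divr_ge0.
have h2 : 0 <= rho A / 2 by exact: divr_ge0.
rewrite (ler_powR_inv r0 (ltW l0) h4) (ltr_powR_inv r0 (ltW l0) h2).
have -> : (rho A / 4 <= l `^ r < rho A / 2) = (2 * l `^ r < rho A <= 4 * l `^ r).
  by rewrite ler_pdivrMr// ltr_pdivlMr// andbC ![_ `^ _ * _]mulrC.
by case: ifP => _; rewrite ?mulr1 ?mulr0.
Qed.

End Weight.

Definition normq g : R := fine (wint q (lvl g)).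

Lemma normqE g : (forall x, 0 <= g x) -> (normq g)%:E = wint q (lvl g).
Proof.
move=> g0; rewrite /normq fineK//.
have [s [tau st]] := stopping_time_exists om g0.
rewrite ge0_fin_numE; first exact: le_lt_trans (wint_level_le g0 st) (ltry _).
by apply: wint_ge0 => // l _; apply: level_ge0 => //; exact: mass_set0.
Qed.

Lemma normq_le g s tau : (forall x, 0 <= g x) -> stopping_time nu g s tau ->
  normq g <= \sum_x g x * tau x `^ (theta - 1).
Proof. by move=> g0 st; rewrite -lee_fin normqE//; apply: wint_level_le st. Qed.

Lemma normq_ge g s tau : (forall x, 0 <= g x) -> stopping_time nu g s tau ->
  \sum_x g x * tau x `^ (theta - 1) <= weight_const^-1 * normq g.
Proof.
move=> g0 st; rewrite ler_pdivlMl ?weight_const_gt0// -lee_fin normqE//.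
exact: wint_level_ge st.
Qed.

Lemma restr_ge0 g A : (forall x, 0 <= g x) -> forall x, 0 <= restr A g x.
Proof. by move=> g0 x; rewrite /restr; case: ifP. Qed.

Lemma restr_le g A : (forall x, 0 <= g x) -> forall x, restr A g x <= g x.
Proof. by move=> g0 x; rewrite /restr; case: ifP. Qed.

Lemma sum_restr g A (h : T -> R) :
  \sum_x restr A g x * h x = \sum_(x in A) g x * h x.
Proof.
rewrite [RHS]big_mkcond; apply: eq_bigr => x _; rewrite /restr.
by case: ifP; rewrite ?mul0r.
Qed.

(** Each piece is evaluated along its own stopping time, which [stopping_weight_ge0] with a = theta
    - 1 replaces by that of [g]; the sums over disjoint sets then add up. *)
Lemma normq_superadditive g (m H : {set T} -> R) (s : seq {set T}) :
  (forall x, 0 <= g x) -> 1 <= theta -> greedy m H id s ->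
  \sum_(A <- s) normq (restr A g) <=
    2 * 2 `^ (theta - 1) * weight_const^-1 * normq g.
Proof.
move=> g0 th1 gs; have [s' [tau st]] := stopping_time_exists om g0.
rewrite -mulrA.
apply: le_trans (ler_wpM2l _ (normq_ge g0 st)); last by rewrite mulr_ge0 ?powR_ge0.
apply: (@le_trans _ _ (\sum_(A <- s) 2 * 2 `^ (theta - 1) *
    \sum_(x in A) g x * tau x `^ (theta - 1))).
  apply: ler_sum => A _.
  have rg0 := restr_ge0 A g0.
  have [sA [tA stA]] := stopping_time_exists om rg0.
  apply: le_trans (normq_le rg0 stA) _; rewrite -sum_restr.
  apply: (stopping_weight_ge0 om rg0 (restr_le A g0) st stA); lra.
rewrite -mulr_sumr ler_wpM2l ?mulr_ge0 ?powR_ge0//.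
rewrite (greedy_sum (fun=> subxx _) _ gs) [leRHS](bigID [in union s])/= lerDl.
by apply: sumr_ge0 => x _; rewrite mulr_ge0 ?powR_ge0.
Qed.

Section Cover.
Variables (I : finType) (D : I -> {set T}).
Hypothesis cD : forall x, exists i, x \in D i.

Lemma stopping_choice g : (forall x, 0 <= g x) ->
  exists (s : I -> seq {set T}) (tau : I -> T -> R),
    forall i, stopping_time nu (restr (D i) g) (s i) (tau i).
Proof.
move=> g0.
have /fin_all_exists[F HF] : forall i, exists p : seq {set T} * (T -> R),
    stopping_time nu (restr (D i) g) p.1 p.2.
  move=> i; have [s [tau st]] := stopping_time_exists om (restr_ge0 (D i) g0).
  by exists (s, tau).
by exists (fun i => (F i).1), (fun i => (F i).2).
Qed.

(** The replacement in the other direction: the weights of [g] are bounded on each piece by those of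
    the piece, through [stopping_weight_le0] with a = theta - 1. *)
Lemma normq_subadditive g : (forall x, 0 <= g x) -> theta <= 1 ->
  normq g <= theta^-1 * weight_const^-1 * \sum_i normq (restr (D i) g).
Proof.
move=> g0 th1; have [s' [tau st]] := stopping_time_exists om g0.
have [s [taui sti]] := stopping_choice g0.
apply: le_trans (normq_le g0 st) _.
apply: (@le_trans _ _ (\sum_i \sum_x restr (D i) g x * tau x `^ (theta - 1))).
  rewrite exchange_big/=; apply: ler_sum => x _.
  rewrite -mulr_suml ler_wpM2r ?powR_ge0//.
  have [i xi] := cD x; rewrite (bigD1 i)//= {1}/restr xi lerDl.
  by apply: sumr_ge0 => j _; exact: restr_ge0.
rewrite mulr_sumr; apply: ler_sum => i _.
have rg0 := restr_ge0 (D i) g0.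
apply: le_trans (stopping_weight_le0 om rg0 (restr_le _ g0) st (sti i) _ _) _.
- by rewrite ltrBDl; move: theta0; lra.
- by rewrite subr_le0.
rewrite addrC subrK -mulrA ler_wpM2l ?invr_ge0 ?(ltW theta0)//.
exact: normq_ge (sti i).
Qed.

(** Integrates [level_dilated] at t = l^r / K: the densities of the pieces are multiplied by K,
    their contributions by K^theta. *)
Lemma normq_dilated g K : (forall x, 0 <= g x) -> 0 < K ->
  (forall U, \sum_i nu (U :&: D i) <= K * nu U) ->
  normq g <= K `^ theta * weight_const^-1 * \sum_i normq (restr (D i) g).
Proof.
move=> g0 K0 hK; have [s [taui sti]] := stopping_choice g0.
pose rho i := density nu (mass (restr (D i) g)).
have rho0 i A : 0 <= rho i A.
  by apply: density_ge0 => // B; apply: mass_ge0; exact: restr_ge0.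
pose M i l := \sum_(A <- s i) nu A * (0 <= l < (K * rho i A) `^ r^-1)%R%:R : R.
have mM i : measurable_fun (`]0%R, +oo[%classic : set R) (M i).
  exact: (@measurable_steps R {set T} (s i) (fun=> 0)).
apply: (@le_trans _ _ (\sum_i K `^ theta * \sum_x restr (D i) g x * taui i x `^ (theta - 1))).
  rewrite -lee_fin normqE//.
  apply: (@le_trans _ _ (wint q (fun l => \sum_i M i l))).
    apply: le_wint => //.
    - exact: noninc_pos_measurable (level_noninc_pos om (mass_set0 g) r0).
    - exact: measurable_sum.
    - by move=> l _; apply: level_ge0 => //; exact: mass_set0.
    move=> l l0.
    have t0 : 0 <= l `^ r / K by rewrite divr_ge0 ?powR_ge0// ltW.
    have := level_dilated om g0 t0 cD hK sti.
    rewrite mulrC divfK ?gt_eqF// => /le_trans; apply.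
    apply: ler_sum => i _; rewrite big_mkcond; apply: ler_sum => A _.
    rewrite (ltW l0)/= (ltr_powR_inv r0 (ltW l0) (mulr_ge0 (ltW K0) (rho0 i A))).
    rewrite (mulrC K) (ltr_pdivrMr _ _ K0) -/(rho i A).
    by case: ifP => _; rewrite ?mulr1 ?mulr0.
  rewrite wint_sum//; last first.
    by move=> i l _; apply: sumr_ge0 => A _; rewrite mulr_ge0 ?outer_ge0.
  rewrite -sumEFin; apply: lee_sum => i _.
  rewrite (@wint_steps R q _ (s i) (fun=> 0) (fun A => (K * rho i A) `^ r^-1) nu)//; last 2 first.
  - by move=> A; exact: outer_ge0.
  - by move=> A; exact: powR_ge0.
  rewrite lee_fin -(st_weight om (restr_ge0 (D i) g0) (sti i) theta0) mulr_sumr.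
  apply: ler_sum => A _; rewrite powR0 ?gt_eqF// subr0 -powRrM (mulrC r^-1).
  by rewrite powRM ?(ltW K0)// mulrCA.
rewrite mulr_sumr; apply: ler_sum => i _; rewrite -mulrA ler_wpM2l ?powR_ge0//.
exact: normq_ge (restr_ge0 _ g0) (sti i).
Qed.

End Cover.

End AdditiveNorm.

(** * Iterated quasi-norms *)

Section Superlevels.
Context {R : realType} {T : finType}.
Implicit Types (A B : {set T}) (m H : {set T} -> R) (f : T -> R).

Lemma restrI A B f : restr A (restr B f) = restr (A :&: B) f.
Proof.
by apply/funext => x; rewrite /restr inE; case: (x \in A); case: (x \in B).
Qed.

Lemma restrT f : restr finset.setT f = f.
Proof. by apply/funext => x; rewrite /restr inE. Qed.

Lemma outerLinf_leP (S : (T -> R) -> {set T} -> \bar R) f (l : R) : 0 <= l ->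
  (outerLinf S f <= l%:E)%E <->
  (forall A, A != finset.set0 -> (S f A <= l%:E)%E).
Proof.
move=> l0; split => [h A An0|h].
  by apply: le_trans h; rewrite /outerLinf; apply: le_bigmax_cond.
by rewrite /outerLinf; apply: bigmax_le.
Qed.

Lemma superlevel_minval m S f (l : R) (P : {set T} -> bool) :
  (forall B, (outerLinf S (restr (~: B) f) <= l%:E)%E <-> P B) -> P finset.setT ->
  outer_superlevel m S f l = (minval P m)%:E.
Proof.
move=> hP PT; apply/eqP; rewrite eq_le; apply/andP; split.
  have [B PB <-] := minval_attained m PT.
  by apply: ereal_inf_lbound; exists B => //=; apply/hP.
by apply: le_ereal_inf_tmp => _ [B /hP PB <-]; rewrite lee_fin minval_le.
Qed.

Lemma lsize_le (x y p l : R) : 0 < p -> 0 < y -> 0 <= x -> 0 < l ->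
  (y `^ (- p^-1) * x `^ p^-1 <= l) = (x <= l `^ p * y).
Proof.
move=> p0 y0 x0 l0.
rewrite powRN ler_pdivrMl ?powR_gt0//.
rewrite -[l in LHS](powRVK (p := p^-1)) ?invr_gt0// ?(ltW l0)// invrK.
rewrite -powRM ?powR_ge0 ?(ltW y0)// mulrC.
apply/idP/idP => h; last first.
  by apply: ler_powR_root; rewrite ?mulr_ge0 ?powR_ge0 ?(ltW y0).
rewrite leNgt; apply/negP => h'; move: h; apply/negP; rewrite -ltNge.
by apply: gt0_ltr_powR; rewrite ?nnegrE ?invr_gt0 ?mulr_ge0 ?powR_ge0 ?(ltW y0).
Qed.

(** Links the sizes, tested on every nonempty [A], with [admissible], tested only on subsets of the
    complement of [B]: replacing [A] by its part off [B] keeps [H] and can only lower [m]. *)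
Lemma superlevel_lsize m H (p : R) (N : (T -> R) -> \bar R) f (l : R) :
  outer_meas m -> 0 < p -> 0 < l -> (forall A, 0 <= H A) -> H finset.set0 = 0 ->
  (forall A, N (restr A f) = (H A `^ p^-1)%:E) ->
  outer_superlevel m (lsize p%:E m N) f l = (level H m (l `^ p))%:E.
Proof.
move=> om p0 l0 H0 Hz NE; apply: superlevel_minval => [B|]; last exact: admissibleT.
rewrite outerLinf_leP ?(ltW l0)//.
have szE A : A != finset.set0 ->
    (lsize p%:E m N (restr (~: B) f) A <= l%:E)%E = (H (A :&: ~: B) <= l `^ p * m A).
  move=> An0; rewrite /lsize restrI NE /expinv -EFinM lee_fin lsize_le//.
  exact: outer_gt0.
split => [h|/admissibleP h A An0].
  apply/admissibleP => A AB.
  have [->|An0] := eqVneq A finset.set0; first by rewrite Hz mulr_ge0 ?powR_ge0 ?outer_ge0.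
  by move: (h A An0); rewrite szE//; move/finset.setIidPl: AB => ->.
rewrite szE//; apply: le_trans (h _ (finset.subsetIr _ _)) _.
by rewrite ler_wpM2l ?powR_ge0//; apply: outer_mono => //; exact: finset.subsetIl.
Qed.

Lemma outerLp_wint (p : R) m (S : (T -> R) -> {set T} -> \bar R) f (L : R -> R) (x : R) :
  (forall l, 0 < l -> outer_superlevel m S f l = (L l)%:E) ->
  x%:E = wint p L -> outerLp p%:E m S f = (x `^ p^-1)%:E.
Proof.
move=> hL xE; rewrite /outerLp.
rewrite (_ : (\int[_]_(l in _) _)%E = x%:E) ?poweR_EFin// xE.
apply: eq_integral => l; rewrite inE/= in_itv/= andbT => l0.
by rewrite hL.
Qed.

End Superlevels.

Section Norm2.
Context {R : realType} {T : finType}.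
Variables (nu : {set T} -> R) (w : T -> R) (q : R) (r : \bar R).
Hypotheses (om : outer_meas nu) (w0 : pos_weight w) (q0 : 0 < q) (r0 : (0 < r)%E).
Implicit Types (f : T -> R) (A : {set T}).

Definition pdens (r' : R) f x : R := w x * `|f x| `^ r'.

Lemma pdens_ge0 r' f x : 0 <= pdens r' f x.
Proof. by rewrite mulr_ge0 ?powR_ge0// ltW// w0. Qed.

Lemma pdens_restr r' f A : 0 < r' -> pdens r' (restr A f) = restr A (pdens r' f).
Proof.
move=> r'0; apply/funext => x; rewrite /pdens /restr; case: ifP => // _.
by rewrite normr0 powR0 ?gt_eqF// mulr0.
Qed.

Definition superlevel2 f (l : R) : R :=
  if r is r'%:E then level (mass (pdens r' f)) nu (l `^ r') else nu (exceed f l).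

(** The q-th power of the double quasi-norm, as [norm2E] shows; [nrmE] gives its finiteness. *)
Definition nrm f : R := fine (wint q (superlevel2 f)).

Lemma superlevel2_noninc f : noninc_pos (superlevel2 f).
Proof.
rewrite /superlevel2; case: r r0 => [r'| |]//= r'0.
  by apply: level_noninc_pos => //; exact: mass_set0.
split => [l l0|l l' l0 ll']; first exact: outer_ge0.
apply: outer_mono => //; apply/fintype.subsetP => x; rewrite !inE; exact: le_lt_trans.
Qed.

Lemma nrmE f : (nrm f)%:E = wint q (superlevel2 f).
Proof.
rewrite /nrm /superlevel2; case: r r0 => [r'| |]//= r'0.
  by apply: (normqE om) => // x; exact: pdens_ge0.
rewrite fineK// ge0_fin_numE; last by apply: wint_ge0 => // l _; exact: outer_ge0.
(* The superlevel measures vanish from [b] on, so a single step of height [nu setT] dominates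
   them. *)
pose b := \sum_x `|f x|.
apply: (@le_lt_trans _ _ (\sum_(i <- [:: tt]) nu finset.setT * b `^ q)%:E); last exact: ltry.
apply: wint_le_steps => //.
- split => [l l0|l l' l0 ll']; first exact: outer_ge0.
  apply: outer_mono => //; apply/fintype.subsetP => x; rewrite !inE; exact: le_lt_trans.
- by move=> _; exact: outer_ge0.
- by move=> _; exact: sumr_ge0.
move=> l l0; rewrite big_seq1; case: ltP => lb.
  by rewrite mulr1; apply: outer_mono => //; exact: finset.subsetT.
rewrite mulr0 -(outer0 om); apply: outer_mono => //; apply/fintype.subsetP => x.
rewrite !inE ltNge; apply: contraNT => _; apply: le_trans lb.
by rewrite /b (bigD1 x)//= lerDl sumr_ge0.
Qed.

Lemma nrm_ge0 f : 0 <= nrm f.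
Proof.
by apply: fine_ge0; apply: wint_ge0 => // l l0; case: (superlevel2_noninc f) => + _; apply.
Qed.

Lemma superlevel2_zero f (l : R) : (forall x, f x = 0) -> 0 < l -> superlevel2 f l = 0.
Proof.
move=> fz l0; rewrite /superlevel2; case: r r0 => [r'| |]//= r'0.
  apply: level_mass0 => //; first exact: powR_ge0.
  by move=> x; rewrite /pdens fz normr0 powR0 ?gt_eqF// mulr0.
rewrite (_ : exceed f l = finset.set0) ?outer0//.
by apply/finset.setP => x; rewrite !inE fz normr0 ltNge (ltW l0).
Qed.

Lemma nrm0 f : nrm (restr finset.set0 f) = 0.
Proof.
rewrite /nrm (_ : wint _ _ = 0%E)//; apply: integral0_eq => l.
rewrite /= in_itv/= andbT => l0; rewrite superlevel2_zero ?mule0// => x.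
by rewrite /restr inE.
Qed.

(** For r = oo the sizes are plain suprema; testing singletons shows that the admissible sets are
    those containing [exceed f l]. *)
Lemma outer_superlevel2 f (l : R) : 0 < l ->
  outer_superlevel nu (lsize r nu (Lr_omega r w)) f l = (superlevel2 f l)%:E.
Proof.
move=> l0; rewrite /superlevel2; case: r r0 => [r'| |]//= r'0.
  apply: (@superlevel_lsize _ _ nu (mass (pdens r' f)) r' (Lr_omega r'%:E w) f l om r'0 l0).
  - by move=> A; apply: mass_ge0 => x; exact: pdens_ge0.
  - exact: mass_set0.
  move=> A; rewrite /Lr_omega /mass; congr ((_ `^ _)%:E).
  rewrite [RHS]big_mkcond; apply: eq_bigr => x _; rewrite /restr /pdens.
  by case: ifP => // _; rewrite normr0 powR0 ?gt_eqF// mulr0.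
rewrite (@superlevel_minval _ _ _ _ _ _ (fun B => exceed f l \subset B)).
- congr (_%:E); apply/eqP; rewrite eq_le minval_le//=.
  have [B sB <-] := @minval_attained R T (fun B => exceed f l \subset B) nu (finset.subsetT _).
  exact: outer_mono.
- move=> B; rewrite outerLinf_leP ?(ltW l0)//; split => [h|/fintype.subsetP h A An0].
    apply/fintype.subsetP => x; rewrite inE => lx; apply/negP => /negP xB.
    have /(h) : [set x]%SET != finset.set0 by rewrite -card_gt0 cards1.
    rewrite /lsize /expinv oppr0 powRr0 mul1e restrI /Lr_omega lee_fin leNgt => /negP; apply.
    apply: (lt_le_trans lx); apply: le_trans (le_bigmax _ _ x).
    by rewrite /restr !inE eqxx xB.
  rewrite /lsize /expinv oppr0 powRr0 mul1e restrI /Lr_omega lee_fin.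
  apply: bigmax_le => [|x _]; first exact: ltW.
  rewrite /restr !inE; case: ifP => [/andP[_ xB]|_]; last by rewrite normr0 ltW.
  by rewrite leNgt; apply: contra xB => lx; apply: h; rewrite inE.
- exact: finset.subsetT.
Qed.

Lemma norm2E f : norm2 q%:E r nu w f = ((nrm f) `^ q^-1)%:E.
Proof.
by apply: outerLp_wint (nrmE f) => l l0; exact: outer_superlevel2.
Qed.

Lemma nrm_pieces (s : seq {set T}) K f : 0 <= K ->
  (forall U, \sum_(A <- s) nu (U :&: A) <= K * nu U) ->
  \sum_(A <- s) nrm (restr A f) <= K * nrm f.
Proof.
move=> K0 hs; have mL g : measurable_fun (`]0%R, +oo[%classic : set R) (superlevel2 g).
  by apply: noninc_pos_measurable; exact: superlevel2_noninc.
have L0 g (l : R) : 0 < l -> 0 <= superlevel2 g l.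
  by case: (superlevel2_noninc g) => + _; apply.
rewrite -lee_fin EFinM nrmE -sumEFin.
under eq_bigr do rewrite nrmE.
rewrite -wint_sum//; last by move=> A; exact: L0.
rewrite -wintZ//; last exact: L0.
apply: le_wint => //.
- exact: measurable_sum.
- by apply: measurable_funM => //; exact: mL.
- by move=> l l0; apply: sumr_ge0 => A _; exact: L0.
move=> l l0; rewrite /superlevel2; case: r r0 => [r'| |]//= r'0.
  under eq_bigr do rewrite pdens_restr//.
  by apply: level_pieces => //; exact: powR_ge0.
by apply: exceed_pieces => //; exact: ltW.
Qed.

(** At r = oo the value 1 is a default here, as r <= q < oo excludes that case; in [sub_const] and
    [dilate_const] it is the constant given by subadditivity of [nu]. *)
Definition super_const : R :=
  if r is r'%:E then 2 * 2 `^ (q / r' - 1) * (weight_const q r')^-1 else 1.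
Definition sub_const : R := if r is r'%:E then (q / r')^-1 * (weight_const q r')^-1 else 1.
Definition dilate_const (K : R) : R :=
  if r is r'%:E then K `^ (q / r') * (weight_const q r')^-1 else 1.

Lemma super_const_gt0 : 0 < super_const.
Proof.
rewrite /super_const; case: r r0 => [r'| |]//= r'0.
by rewrite !mulr_gt0 ?powR_gt0// invr_gt0 weight_const_gt0.
Qed.

Lemma sub_const_gt0 : 0 < sub_const.
Proof.
rewrite /sub_const; case: r r0 => [r'| |]//= r'0.
by rewrite mulr_gt0 ?invr_gt0 ?divr_gt0// weight_const_gt0.
Qed.

Lemma dilate_const_gt0 K : 0 < K -> 0 < dilate_const K.
Proof.
move=> K0; rewrite /dilate_const; case: r r0 => [r'| |]//= r'0.
by rewrite mulr_gt0 ?powR_gt0// invr_gt0 weight_const_gt0.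
Qed.

Lemma nrm_superadditive f (m H : {set T} -> R) (s : seq {set T}) :
  (r <= q%:E)%E -> greedy m H id s ->
  \sum_(A <- s) nrm (restr A f) <= super_const * nrm f.
Proof.
rewrite /nrm /superlevel2 /super_const; case: r r0 => [r'| |]//= r'0.
rewrite lee_fin => rq gs.
under eq_bigr do rewrite pdens_restr//.
apply: (normq_superadditive om q0 r'0 _ _ gs); first by move=> x; exact: pdens_ge0.
by rewrite ler_pdivlMr// mul1r.
Qed.

Section Cover.
Variables (I : finType) (D : I -> {set T}).
Hypothesis cD : forall x, exists i, x \in D i.

Lemma nrm_le_sum f :
  (forall l, 0 < l -> superlevel2 f l <= \sum_i superlevel2 (restr (D i) f) l) ->
  nrm f <= \sum_i nrm (restr (D i) f).
Proof.
move=> hf; have mL g : measurable_fun (`]0%R, +oo[%classic : set R) (superlevel2 g).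
  by apply: noninc_pos_measurable; exact: superlevel2_noninc.
have L0 g (l : R) : 0 < l -> 0 <= superlevel2 g l.
  by case: (superlevel2_noninc g) => + _; apply.
rewrite -lee_fin nrmE -sumEFin.
under [leRHS]eq_bigr do rewrite nrmE.
rewrite -wint_sum//; last by move=> A; exact: L0.
apply: le_wint => //; first exact: measurable_sum.
by move=> l; exact: L0.
Qed.

Lemma nrm_subadditive f : (q%:E <= r)%E ->
  nrm f <= sub_const * \sum_i nrm (restr (D i) f).
Proof.
move=> qr; have := @nrm_le_sum f; move: qr.
rewrite /nrm /superlevel2 /sub_const; case: r r0 => [r'| |]//= r'0.
  rewrite lee_fin => qr _.
  under eq_bigr do rewrite pdens_restr//.
  apply: (normq_subadditive om q0 r'0 cD); first by move=> x; exact: pdens_ge0.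
  by rewrite ler_pdivrMr// mul1r.
move=> _; rewrite mul1r; apply => l l0.
by apply: exceed_cover => //; exact: ltW.
Qed.

Lemma nrm_dilated f K : 0 < K -> (forall U, \sum_i nu (U :&: D i) <= K * nu U) ->
  nrm f <= dilate_const K * \sum_i nrm (restr (D i) f).
Proof.
move=> K0 hK; have := @nrm_le_sum f.
rewrite /nrm /superlevel2 /dilate_const; case: r r0 => [r'| |]//= r'0.
  move=> _; under eq_bigr do rewrite pdens_restr//.
  by apply: (normq_dilated om q0 r'0 cD) => // x; exact: pdens_ge0.
rewrite mul1r; apply => l l0.
by apply: exceed_cover => //; exact: ltW.
Qed.

End Cover.
End Norm2.

(** * The triple quasi-norm with equal outer exponents *)

Section Norm3.
Context {R : realType} {T : finType}.
Variables (mu : {set T} -> R) (H : {set T} -> R) (q : R).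
Hypotheses (om : outer_meas mu) (q0 : 0 < q) (H0 : forall A, 0 <= H A)
  (Hz : H finset.set0 = 0).

Definition nrm3 : R := fine (wint q (fun l => level H mu (l `^ q))).

Section Upper.
Variables (Cov : {set T} -> {set T}) (Phi : R) (s : seq {set T}).
Hypotheses (Cov_mono : forall A B : {set T}, A \subset B -> Cov A \subset Cov B)
  (mCov : forall A, mu (Cov A) <= Phi * mu A) (Phi0 : 0 <= Phi)
  (gs : greedy mu H Cov s)
  (hs : forall B : {set T}, B \subset ~: Cov (union s) -> H B <= 0).

(** The superlevel measure at l is at most Phi times the sum of [mu A] over the selected sets of
    density above l^q; integrating in l turns each [mu A] into [mu A] times its density, that is
    [H A]. *)
Lemma wint_level_greedy :
  (wint q (fun l => level H mu (l `^ q)) <= (Phi * \sum_(A <- s) H A)%:E)%E.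
Proof.
have rho0 A : 0 <= density mu H A by exact: density_ge0.
rewrite mulr_sumr.
rewrite (eq_bigr (fun A => (Phi * mu A) * (density mu H A `^ q^-1) `^ q)); last first.
  by move=> A _; rewrite powRVK// -mulrA (mulrC (mu A)) -(densityK om Hz).
apply: wint_le_steps => //.
- exact: level_noninc_pos om Hz q0.
- by move=> A; rewrite mulr_ge0 ?outer_ge0.
- by move=> A; exact: powR_ge0.
move=> l l0; apply: le_trans (greedy_level om Hz Cov_mono gs (powR_ge0 l q) hs) _.
apply: le_trans (mCov _) _.
apply: (@le_trans _ _ (Phi * \sum_(A <- s | l `^ q < density mu H A) mu A)).
  rewrite ler_wpM2l//; apply: outer_bigcup => // x /unionP[A].
  by rewrite mem_filter => /andP[lA As] xA; exists A => //; rewrite lA.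
rewrite mulr_sumr big_mkcond; apply: ler_sum => A _.
rewrite (ltr_powR_inv q0 (ltW l0) (rho0 A)).
by case: ifP => _; rewrite ?mulr1 ?mulr0.
Qed.

End Upper.

Lemma nrm3E : nrm3%:E = wint q (fun l => level H mu (l `^ q)).
Proof.
rewrite /nrm3 fineK// ge0_fin_numE; last first.
  by apply: wint_ge0 => // l _; exact: level_ge0.
have [s gs hs] := greedy_exists om Hz (fun A => fintype.subxx (A : {set T})).
apply: (@le_lt_trans _ _ (1 * \sum_(A <- s) H A)%:E); last exact: ltry.
by apply: (wint_level_greedy (Cov := id)) => // A; rewrite mul1r.
Qed.

Lemma nrm3_ge0 : 0 <= nrm3.
Proof. by apply: fine_ge0; apply: wint_ge0 => // l _; exact: level_ge0. Qed.

Lemma nrm3_le_greedy (Cov : {set T} -> {set T}) (Phi : R) (s : seq {set T}) :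
  (forall A B : {set T}, A \subset B -> Cov A \subset Cov B) ->
  (forall A, mu (Cov A) <= Phi * mu A) -> 0 <= Phi ->
  greedy mu H Cov s ->
  (forall B : {set T}, B \subset ~: Cov (union s) -> H B <= 0) ->
  nrm3 <= Phi * \sum_(A <- s) H A.
Proof. by move=> h1 h2 h3 h4 h5; rewrite -lee_fin nrm3E; exact: wint_level_greedy h4 h5. Qed.

(** After the substitution t = l^q the interval between consecutive levels has weight
    [t k - t k.+1]. This is the hypothesis on [I] in [level_chain]. *)
Lemma nrm3_ge_levels (n : nat) (t : nat -> R) :
  (forall k, 0 < t k) -> (forall k, t k.+1 <= t k) ->
  \sum_(k < n) (t k - t k.+1) * level H mu (t k) <= nrm3.
Proof.
move=> t0 tdec; rewrite -lee_fin nrm3E.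
rewrite (eq_bigr (fun k : 'I_n => level H mu (t k) *
    ((t k `^ q^-1) `^ q - (t k.+1 `^ q^-1) `^ q))); last first.
  by move=> k _; rewrite !powRVK ?(ltW (t0 _))// mulrC.
apply: (wint_ge_steps (a := fun k : 'I_n => t k.+1 `^ q^-1)) => //.
- exact: level_noninc_pos om Hz q0.
- by move=> k; exact: level_ge0.
- by move=> k; exact: powR_ge0.
- by move=> k; apply: ler_powR_root => //; exact: ltW.
move=> l l0.
apply: le_trans (sum_steps_le (L := level H mu) n (l `^ q) _ _ tdec).
- apply: ler_sum => k _.
  by rewrite (ler_powR_inv q0 (ltW l0) (ltW (t0 _))) (ltr_powR_inv q0 (ltW l0) (ltW (t0 _))).
- by move=> x y; exact: level_noninc.
- by move=> x; exact: level_ge0.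
Qed.

(** The chain is taken with error e / C, which C turns into e; then e tends to 0. *)
Lemma le_nrm3 (Cov : {set T} -> {set T}) (Phi C : R) : 1 <= Phi -> 0 < C ->
  (forall A, mu (Cov A) <= Phi * mu A) ->
  (forall n (E : nat -> {set T}), E 0%N = finset.set0 -> E n = finset.setT ->
     (forall k, Cov (E k) \subset E k.+1) ->
     H finset.setT <= C * \sum_(k < n) H (E k.+1 :\: E k)) ->
  H finset.setT <= C * (8 * Phi) * nrm3.
Proof.
move=> Phi1 C0 mCov hH; apply/ler_addgt0Pr => e e0.
have [n [E [E0 En hE sE]]] :=
  level_chain om Hz H0 Phi1 mCov nrm3_ge_levels (divr_gt0 e0 C0).
apply: le_trans (hH n E E0 En hE) _.
apply: le_trans (ler_wpM2l (ltW C0) sE) _.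
by rewrite mulrDr (mulrC C (e / C)) divfK ?gt_eqF// !mulrA.
Qed.

End Norm3.

(** * Comparison of the quasi-norms for finite q *)

Section Main.
Context {R : realType} {T : finType}.
Variables (mu nu : {set T} -> R) (w : T -> R) (C : {set T} -> {set {set T}}) (Phi K : R).
Variables (q : R) (r : \bar R) (f : T -> R).
Hypotheses (omu : outer_meas mu) (onu : outer_meas nu) (w0 : pos_weight w)
  (q0 : 0 < q) (r0 : (0 < r)%E) (hC : canopy mu nu C Phi K).
Hypothesis Phi_ge1 : 1 <= Phi.
Hypothesis K_ge1 : 1 <= K.

Let H (A : {set T}) := nrm nu w q r (restr A f).
Let H0 A : 0 <= H A. Proof. exact: nrm_ge0. Qed.
Let Hz : H finset.set0 = 0. Proof. exact: nrm0. Qed.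
Let HT : H finset.setT = nrm nu w q r f. Proof. by rewrite /H restrT. Qed.

Lemma norm3E : norm3 q%:E q%:E r mu nu w f = ((nrm3 mu H q) `^ q^-1)%:E.
Proof.
apply: (outerLp_wint (L := fun l => level H mu (l `^ q))); last exact: nrm3E.
move=> l l0; apply: (@superlevel_lsize _ _ mu H q _ f l omu q0 l0 H0 Hz) => A.
exact: norm2E.
Qed.

Let muId A : mu (id A) <= 1 * mu A. Proof. by rewrite mul1r. Qed.

Lemma nrm3_le_super : (r <= q%:E)%E -> nrm3 mu H q <= super_const q r * nrm nu w q r f.
Proof.
move=> rq.
have [s gs hs] := greedy_exists omu Hz (fun A => fintype.subxx (A : {set T})).
have hmono (A B : {set T}) : A \subset B -> id A \subset id B by [].
apply: le_trans (nrm3_le_greedy omu q0 H0 Hz hmono muId ler01 gs hs) _.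
by rewrite mul1r; exact: nrm_superadditive gs.
Qed.

Lemma nrm3_le_canopy : nrm3 mu H q <= Phi * K * nrm nu w q r f.
Proof.
have [s gs hs] := greedy_exists omu Hz (canopy_sub hC).
have Phi0 : 0 <= Phi by apply: le_trans Phi_ge1.
apply: le_trans (nrm3_le_greedy omu q0 H0 Hz (canopy_mono hC) (canopy_mu hC) Phi0 gs hs) _.
rewrite -mulrA ler_wpM2l//; apply: nrm_pieces => //; first by apply: le_trans K_ge1.
by move=> U; exact: (greedy_carath onu hC U K_ge1 gs).
Qed.

(** The chain is built with the identity in place of the canopy, so [Phi] becomes 1. *)
Lemma nrm_le_sub : (q%:E <= r)%E -> nrm nu w q r f <= sub_const q r * 8 * nrm3 mu H q.
Proof.
move=> qr; rewrite -HT.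
have := @le_nrm3 _ _ mu H q omu q0 H0 Hz id 1 (sub_const q r) (lexx _) _ muId.
rewrite mulr1; apply; first exact: sub_const_gt0.
move=> n E E0 En _; rewrite HT.
exact: (nrm_subadditive onu w0 q0 r0 (layers_cover E0 En)).
Qed.

(** The parameter is 2 K because the layers split by parity into two Caratheodory families. *)
Lemma nrm_le_canopy :
  nrm nu w q r f <= dilate_const q r (2 * K) * (8 * Phi) * nrm3 mu H q.
Proof.
have K0 : 0 < 2 * K by rewrite mulr_gt0// (lt_le_trans ltr01 K_ge1).
rewrite -HT.
apply: (le_nrm3 omu q0 H0 Hz Phi_ge1 _ (canopy_mu hC)); first exact: dilate_const_gt0.
move=> n E E0 En hE; rewrite HT.
apply: (nrm_dilated onu w0 q0 r0 (layers_cover E0 En)) => // U.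
exact: (layers_carath onu hC).
Qed.

Lemma norm_le_root (x y c : R) : 0 <= x -> 0 <= y -> 0 <= c -> x <= c * y ->
  x `^ q^-1 <= c `^ q^-1 * y `^ q^-1.
Proof.
move=> x0 y0 c0 xy; rewrite -powRM//; apply: ler_powR_root => //.
exact: mulr_ge0.
Qed.

Lemma norm3_le (c : R) : 0 <= c -> nrm3 mu H q <= c * nrm nu w q r f ->
  (norm3 q%:E q%:E r mu nu w f <= (c `^ q^-1)%:E * norm2 q%:E r nu w f)%E.
Proof.
move=> c0 h; rewrite norm3E norm2E// -EFinM lee_fin.
by apply: norm_le_root => //; [exact: nrm3_ge0|exact: nrm_ge0].
Qed.

Lemma norm3_ge (c : R) : 0 < c -> nrm nu w q r f <= c * nrm3 mu H q ->
  ((c `^ q^-1)^-1%:E * norm2 q%:E r nu w f <= norm3 q%:E q%:E r mu nu w f)%E.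
Proof.
move=> c0 h; rewrite norm3E norm2E// -EFinM lee_fin ler_pdivrMl ?powR_gt0//.
by apply: norm_le_root => //; [exact: nrm_ge0|exact: nrm3_ge0|exact: ltW].
Qed.

End Main.

(** * The case q = oo *)

Section Infinity.
Context {R : realType} {T : finType}.
Variables (mu nu : {set T} -> R) (w : T -> R) (r : \bar R) (f : T -> R).
Hypotheses (w0 : pos_weight w) (r0 : (0 < r)%E).

Lemma Lr_omega_restr A g : (Lr_omega r w (restr A g) <= Lr_omega r w g)%E.
Proof.
have le_abs x : `|restr A g x| <= `|g x| by rewrite /restr; case: ifP; rewrite ?normr0.
rewrite /Lr_omega; case: r r0 => [r' r'0|_|//]; last first.
  by rewrite lee_fin; apply: le_bigmax2 => x _.
rewrite lte_fin in r'0; rewrite lee_fin.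
have sum0 (h : T -> R) : 0 <= \sum_x w x * `|h x| `^ r'.
  by apply: sumr_ge0 => x _; rewrite mulr_ge0 ?powR_ge0// ltW// w0.
apply: ler_powR_root => //; apply: ler_sum => x _; rewrite ler_pM2l ?w0//.
apply: ge0_ler_powR; rewrite ?nnegrE ?(ltW r'0)//.
Qed.

(** With exponent oo the factor mu(A)^(-1/q) is 1, so the triple quasi-norm is the supremum of the
    double one over restrictions, attained without restricting. *)
Lemma norm3_infty : norm3 +oo%E +oo%E r mu nu w f = norm2 +oo%E r nu w f.
Proof.
rewrite /norm3 /norm2 /=.
have sz m N g (A : {set T}) : lsize +oo%E m N g A = N (restr A g) :> \bar R.
  by rewrite /lsize /expinv oppr0 powRr0 mul1e.
set S := lsize r nu _.
have S0 : (0 <= outerLinf S f)%E.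
  by rewrite /outerLinf; elim/big_rec: _ => // A x _ x0; rewrite le_max x0 orbT.
apply/eqP; rewrite eq_le; apply/andP; split.
  apply: bigmax_le => // A An0; rewrite sz /=.
  apply: bigmax_le => // B Bn0.
  apply: (@le_trans _ _ (S f B)); last by rewrite /outerLinf; apply: le_bigmax_cond.
  rewrite /S /lsize restrI finset.setIC -restrI lee_wpmul2l ?lee_fin ?powR_ge0//.
  exact: Lr_omega_restr.
(* If X is empty there is no nonempty set to test, and both sides are the default value 0 of the
   maximum. *)
have [T0|Tn0] := eqVneq (finset.setT : {set T}) finset.set0.
  have e0 (A : {set T}) : (A != finset.set0) = false.
    by rewrite -finset.subset0 -T0 finset.subsetT.
  by rewrite /outerLinf !big_pred0.
apply: (@le_trans _ _ (lsize +oo%E mu (fun g => outerLinf S g) f finset.setT)).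
  by rewrite sz restrT.
by rewrite [leRHS]/outerLinf; apply: le_bigmax_cond.
Qed.

End Infinity.

Theorem theorem1p1 (R : realType) (q r : \bar R) :
  exponent_ok q -> exponent_ok r ->
  exists C1 C2 : R -> R -> R,
    (forall Phi K, 1 <= Phi -> 1 <= K -> 0 < C1 Phi K /\ 0 < C2 Phi K) /\
    (((q <= r)%E \/ q = +oo%E) ->
       forall Phi K Phi' K', 1 <= Phi -> 1 <= K -> 1 <= Phi' -> 1 <= K' ->
         C1 Phi K = C1 Phi' K') /\
    ((r <= q)%E ->
       forall Phi K Phi' K', 1 <= Phi -> 1 <= K -> 1 <= Phi' -> 1 <= K' ->
         C2 Phi K = C2 Phi' K') /\
    forall (Phi K : R), 1 <= Phi -> 1 <= K ->
    forall (T : finType) (mu nu : {set T} -> R) (w : T -> R)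
           (C : {set T} -> {set {set T}}),
      outer_meas mu -> outer_meas nu -> pos_weight w ->
      canopy mu nu C Phi K ->
      forall f : T -> R,
        (norm3 q q r mu nu w f < +oo)%E ->
        ((C1 Phi K)^-1%:E * norm2 q r nu w f <= norm3 q q r mu nu w f)%E /\
        (norm3 q q r mu nu w f <= (C2 Phi K)%:E * norm2 q r nu w f)%E.
Proof.
rewrite /exponent_ok; case: q => [q| |]// q0 r0; last first.
  exists (fun _ _ => 1), (fun _ _ => 1); split; first by move=> *; split.
  split; first by [].
  split; first by [].
  move=> Phi K _ _ T mu nu w C _ _ w0 _ f _.
  by rewrite norm3_infty// invr1 mul1e.
rewrite lte_fin in q0.
(* The estimates concern q-th powers, hence the roots. Branching on the order of q and r makes the
   constants independent of [Phi] and [K] in the required cases. *)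
exists (fun Phi K => (if (q%:E <= r)%E then sub_const q r * 8
                      else dilate_const q r (2 * K) * (8 * Phi)) `^ q^-1),
  (fun Phi K => (if (r <= q%:E)%E then super_const q r else Phi * K) `^ q^-1).
have pos x : 1 <= x -> 0 < x by apply: lt_le_trans.
have C1_gt0 Phi K : 1 <= Phi -> 1 <= K ->
    0 < (if (q%:E <= r)%E then sub_const q r * 8
         else dilate_const q r (2 * K) * (8 * Phi)).
  move=> /pos Phi0 /pos K0; case: ifP => _.
    by rewrite mulr_gt0// sub_const_gt0.
  by rewrite !mulr_gt0// dilate_const_gt0// mulr_gt0.
have C2_gt0 Phi K : 1 <= Phi -> 1 <= K ->
    0 < (if (r <= q%:E)%E then super_const q r else Phi * K).
  move=> /pos Phi0 /pos K0; case: ifP => _; last exact: mulr_gt0.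
  exact: super_const_gt0.
split; first by move=> Phi K h1 h2; rewrite !powR_gt0 ?C1_gt0 ?C2_gt0.
split; first by move=> [->|].
split; first by move=> ->.
move=> Phi K Phi1 K1 T mu nu w C omu onu w0 hC f _; split.
  apply: norm3_ge => //; first exact: C1_gt0.
  case: ifP => qr; first exact: nrm_le_sub.
  exact: (nrm_le_canopy f omu onu w0 q0 r0 hC).
apply: norm3_le => //; first exact/ltW/C2_gt0.
case: ifP => rq; first exact: nrm3_le_super.
exact: (nrm3_le_canopy f omu onu w0 q0 r0 hC).
Qed.
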